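(* Let $\Omega$ be a compact open subset of $\mathbb{Q}_p$ with $\mathfrak{m}(\Omega)>0$. The following are equivalent: (a) $\Omega$ is a spectral set; (b) $\Omega$ is $p$-homogeneous; (c) $\Omega$ tiles $\mathbb{Q}_p$ by translation.
   Context: $p\ge 2$ is a prime. $\mathbb{Q}_p$ is the field of $p$-adic numbers and $\mathbb{Z}_p$ its ring of integers. $v_p$ is the $p$-adic valuation and $|x|_p=p^{-v_p(x)}$. $\mathfrak{m}$ is the Haar measure on $\mathbb{Q}_p$, normalized so that $\mathfrak{m}(\mathbb{Z}_p)=1$. For $a\in\mathbb{Q}_p$ and $n\in\mathbb{Z}$, $B(a,p^{n})=a+p^{-n}\mathbb{Z}_p$ is the closed ball of radius $p^n$. Characters: every $x\in\mathbb{Q}_p$ is written $x=\sum_{n\ge v_p(x)}a_np^n$ with $a_n\in\{0,\dots,p-1\}$. Its fractional part is $\{x\}=\sum_{n=v_p(x)}^{-1}a_np^n$ (an empty sum is $0$). Set $\chi(x)=e^{2\pi i\{x\}}$ and $\chi_y(x)=\chi(yx)$ for $y\in\mathbb{Q}_p$. Spectral set: a Borel set $\Omega$ with $0<\mathfrak{m}(\Omega)<\infty$ is spectral if there is $\Lambda\subset\mathbb{Q}_p$ such that $\{\chi_\lambda|_\Omega\}_{\lambda\in\Lambda}$ is an orthonormal basis of $L^2$ of the probability measure $\mathfrak{m}|_\Omega/\mathfrak{m}(\Omega)$. Such a $\Lambda$ is called a spectrum. Tiling: $\Omega$ tiles $\mathbb{Q}_p$ if there is $T\subset\mathbb{Q}_p$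 with $\sum_{t\in T}1_\Omega(x-t)=1$ for $\mathfrak{m}$-a.e. $x$. Such a $T$ is called a tiling complement. $p$-homogeneity: for a compact open set $\Omega$ and $n\in\mathbb{Z}$, let $\mathcal{N}_n(\Omega)$ be the set of balls of radius $p^{-n}$ that meet $\Omega$. $\Omega$ is $p$-homogeneous if for every $n\in\mathbb{Z}$ one of the following holds: every ball in $\mathcal{N}_n(\Omega)$ contains exactly one ball of $\mathcal{N}_{n+1}(\Omega)$, or every ball in $\mathcal{N}_n(\Omega)$ contains exactly $p$ balls of $\mathcal{N}_{n+1}(\Omega)$. Equivalently, in the finite tree of balls meeting $\Omega$ (edges from a ball to its sub-balls of $1/p$ the radius), the number of children of a vertex depends only on its radius and is $1$ or $p$. *)

(* Defs.v *)
From HB Require Import structures.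
From mathcomp Require Import all_boot all_order all_algebra.
From mathcomp Require Import all_classical all_reals all_analysis.
Set Implicit Arguments. Unset Strict Implicit. Unset Printing Implicit Defensive.
Import Order.TTheory GRing.Theory Num.Theory.
Local Open Scope classical_set_scope.
Local Open Scope ring_scope.

(* The p-adic numbers Q_p, represented by their (unique) p-adic digit  *)
(* expansion x = sum_{n >= v} a_n p^n, a_n in {0,..,p-1}; a_n = 0 for  *)
(* all sufficiently negative n.                                        *)
Record Qp (p : nat) := MkQp {
  dig : int -> nat;
  dig_lt : forall n, (0 < p)%N -> (dig n < p)%N;
  dig_lb : exists N : int, forall n : int, n < N -> dig n = 0%N }.

HB.instance Definition _ p := gen_eqMixin (Qp p).
HB.instance Definition _ p := gen_choiceMixin (Qp p).

Section QpOps.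
Variable p : nat.

Definition qp0 : Qp p.
Proof. by exists (fun _ => 0%N) => // ; exists 0. Defined.

HB.instance Definition _ := isPointed.Build (Qp p) qp0.

Definition lb (x : Qp p) : int := proj1_sig (cid (dig_lb x)).

(* trunc x n = sum_{k < n} a_k p^k  (the representative of x mod p^n Z_p
   in [0, p^n) with finite expansion), as a rational number *)
Definition trunc (x : Qp p) (n : int) : rat :=
  \sum_(i < (if lb x < n then `|n - lb x|%N else 0%N))
     (dig x (lb x + i%:Z))%:R * (p%:R ^ (lb x + i%:Z)).

Definition mkQp (L : int) (f : int -> nat) : Qp p.
Proof.
exists (fun n => if n < L then 0%N else (f n %% p)%N).
- by move=> n hp; case: ifP => // _; rewrite ltn_pmod.
- by exists L => n ->.
Defined.

(* the n-th digit of the p-adic number whose residue mod p^(n+1) is q *)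
Definition digat (q : rat) (n : int) : nat :=
  (`|Num.floor (q / (p%:R ^ n))|%N %% p)%N.

Definition qadd (x y : Qp p) : Qp p :=
  mkQp (Num.min (lb x) (lb y))
    (fun n => digat (trunc x (n + 1) + trunc y (n + 1)) n).

Definition qopp (x : Qp p) : Qp p :=
  mkQp (lb x) (fun n => digat (p%:R ^ (n + 1) - trunc x (n + 1)) n).

Definition qsub (x y : Qp p) : Qp p := qadd x (qopp y).

Definition qmul (x y : Qp p) : Qp p :=
  mkQp (lb x + lb y)
    (fun n => digat (trunc x (n + 1 - lb y) * trunc y (n + 1 - lb x)) n).

Definition fracp (x : Qp p) : rat := trunc x 0.

Definition pZ (n : int) : set (Qp p) := [set z | forall k, k < n -> dig z k = 0%N].

(* closed ball B(a, p^n) = a + p^(-n) Z_p *)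
Definition qball (a : Qp p) (n : int) : set (Qp p) := [set qadd a z | z in pZ (- n)].

Definition qballs : set (set (Qp p)) := [set B | exists a n, B = qball a n].

(* Q_p with its Borel sigma-algebra (generated by the balls) *)
Definition QpM := g_sigma_algebraType qballs.

Definition qp_open (A : set (Qp p)) : Prop :=
  forall x, A x -> exists n : int, qball x n `<=` A.

Definition qp_compact (A : set (Qp p)) : Prop :=
  forall (I : Type) (U : I -> set (Qp p)), (forall i, qp_open (U i)) ->
    A `<=` \bigcup_i U i ->
    exists F : set I, finite_set F /\ A `<=` \bigcup_(i in F) U i.

Definition is_haar (R : realType) (mu : {measure set QpM -> \bar R}) : Prop :=
  (forall (a : Qp p) (A : set QpM), measurable A ->
      mu [set qadd a x | x in A] = mu A) /\
  mu (pZ 0) = 1%E.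

(* chi_y(x) = exp(2 pi i {y x}); we use its argument *)
Definition chi_arg (R : realType) (y x : Qp p) : R :=
  2 * pi * ratr (fracp (qmul y x)).

(* Omega is spectral: {chi_lambda|_Omega}_{lambda in Lambda} is an
   orthonormal basis of L^2(mu|_Omega / mu(Omega)). Complex-valued
   functions are written as pairs (u, v) of real and imaginary parts;
   <f, g> = int_Omega f conj(g) dmu / mu(Omega). *)
Definition spectral (R : realType) (mu : {measure set QpM -> \bar R})
    (Om : set QpM) : Prop :=
  measurable Om /\ (0 < mu Om)%E /\ (mu Om < +oo)%E /\
  exists Lam : set (Qp p),
    (forall l l', Lam l -> Lam l' ->
       (\int[mu]_(x in Om) (cos (chi_arg R l x - chi_arg R l' x))%:E
          = if `[< l = l' >] then mu Om else 0)%E /\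
       (\int[mu]_(x in Om) (sin (chi_arg R l x - chi_arg R l' x))%:E = 0)%E)
    /\
    (forall u v : QpM -> R,
       measurable_fun Om u -> measurable_fun Om v ->
       (\int[mu]_(x in Om) (u x ^+ 2)%:E < +oo)%E ->
       (\int[mu]_(x in Om) (v x ^+ 2)%:E < +oo)%E ->
       (forall l, Lam l ->
          (\int[mu]_(x in Om)
             (u x * cos (chi_arg R l x) + v x * sin (chi_arg R l x))%:E = 0)%E /\
          (\int[mu]_(x in Om)
             (v x * cos (chi_arg R l x) - u x * sin (chi_arg R l x))%:E = 0)%E) ->
       {ae mu, forall x, Om x -> u x = 0 /\ v x = 0}).

Definition tiles (R : realType) (mu : {measure set QpM -> \bar R})
    (Om : set QpM) : Prop :=
  exists T : set (Qp p),
    {ae mu, forall x : QpM, (\esum_(t in T) (\1_Om (qsub x t) : R)%:E = 1)%E}.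

Definition Nballs (Om : set (Qp p)) (n : int) : set (set (Qp p)) :=
  [set B | (exists a, B = qball a (- n)) /\ (B `&` Om !=set0)].

Definition children (Om : set (Qp p)) (n : int) (B : set (Qp p)) :=
  [set B' | Nballs Om (n + 1) B' /\ B' `<=` B].

Definition p_homogeneous (Om : set (Qp p)) : Prop :=
  forall n : int,
    (forall B, Nballs Om n B -> (children Om n B #= `I_1)%card) \/
    (forall B, Nballs Om n B -> (children Om n B #= `I_p)%card).

End QpOps.

(* Main.v *)
Require Import Defs.
From HB Require Import structures.
From mathcomp Require Import all_boot all_order all_algebra all_field.
From mathcomp Require Import all_classical all_reals all_analysis.
From mathcomp Require Import measurable_realfun complex zify ring lra.
Set Implicit Arguments.
Unset Strict Implicit.
Unset Printing Implicit Defensive.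
Import Order.TTheory GRing.Theory Num.Theory.
Local Open Scope classical_set_scope.
Local Open Scope ring_scope.

(** Take [a] and [l] such that [Om] lies in [p^a Z_p] and is a union of cosets
    of [p^(a+l) Z_p].  The digits at the positions [a, ..., a+l-1] turn [Om]
    into a subset [C] of [Z/p^l].  The [p^(j+1)]-th cyclotomic polynomial being
    irreducible over [Q], the character sum of [C] at a primitive
    [p^(j+1)]-th root of unity vanishes exactly when [C] is equidistributed
    among the [p] children of every class mod [p^j].  If [E] is the set of these
    levels [j], then [p^|E| <= |C|], with equality only if [C] has one child at
    every level outside [E], i.e. only if [C] is homogeneous.

    A tiling [C + T = Z/p^l] puts every level in [E] for [C] or for [T], and
    [|C| |T| = p^l] forces equality.  For a spectrum, the frequencies in
    [p^-(a+l) Z_p] pairwise first differ at digits dual to levels of [E], so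
    there are at most [p^|E|] of them, and completeness on the functions
    constant on cosets of [p^(a+l) Z_p] requires at least [|C|] of them.

    Conversely, for a homogeneous set a tiling complement is given by the
    numbers whose digits are supported on the levels with one child, and a
    spectrum by the numbers whose digits are supported on the reflections
    [-n-1] of the levels [n] with [p] children; orthogonality in both variables
    follows from equidistribution, and the resulting inversion formula shows
    that a function orthogonal to the spectrum has integral zero over every
    ball. *)

(** * Vanishing sums of roots of unity of prime power order *)

(** Applied to summands that a shift multiplies by a constant [w]: the full sum then equals [w]
    times itself, and [eq_mul_fix0] makes it vanish. *)
Lemma sum_shift_periodic (V : zmodType) (g : nat -> V) (q s : nat) :
  (forall c, g (c %% q)%N = g c) -> \sum_(c < q) g (c + s)%N = \sum_(c < q) g c.
Proof.
move=> gP; elim: s g gP => [|s IH] g gP.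
  by apply: eq_bigr => i _; rewrite addn0.
case: q gP IH => [|q] gP IH; first by rewrite !big_ord0.
transitivity (\sum_(c < q.+1) g c.+1); last first.
  rewrite big_ord_recr big_ord_recl /= addrC; congr (_ + _).
  by rewrite -gP modnn.
rewrite -(IH (fun c => g c.+1)); last first.
  by move=> c; rewrite -gP -(gP c.+1) -addn1 modnDml addn1.
by apply: eq_bigr => i _; rewrite addnS.
Qed.

Lemma eq_mul_fix0 (F : fieldType) (w s : F) : w != 1 -> s = w * s -> s = 0.
Proof.
move=> w1 /eqP; rewrite -subr_eq0 -{1}[s]mul1r -mulrBl mulf_eq0 subr_eq0.
by rewrite eq_sym (negbTE w1) => /eqP.
Qed.

Lemma prim_root_neq1 (F : nzRingType) n (w : F) :
  (1 < n)%N -> n.-primitive_root w -> w != 1.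
Proof.
move=> n1 /prim_order_dvd/(_ 1%N); rewrite expr1 dvdn1 => h.
by rewrite -h neq_ltn n1 orbT.
Qed.

(* The [p^(k+1)]-th cyclotomic polynomial. *)
Definition cyclo_pp (p k : nat) : {poly rat} := \sum_(j < p) 'X^(p ^ k * j).

Lemma cyclo_pp_mul (p k : nat) :
  ('X^(p ^ k) - 1) * cyclo_pp p k = 'X^(p ^ k.+1) - 1.
Proof.
rewrite /cyclo_pp expnSr exprM [in RHS]subrX1; congr (_ * _).
by apply: eq_bigr => i _; rewrite exprM.
Qed.

Section PrimePower.
Variable p : nat.
Hypothesis p_pr : prime p.

Let p_gt0 : (0 < p)%N. Proof. exact: prime_gt0. Qed.
Let p_gt1 : (1 < p)%N. Proof. exact: prime_gt1. Qed.
Let pX_gt0 k : (0 < p ^ k)%N. Proof. by rewrite expn_gt0 p_gt0. Qed.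

Let pred_pX k : (p ^ k * p = p ^ k * p.-1 + p ^ k)%N.
Proof. by rewrite -mulnSr prednK. Qed.

Lemma size_cyclo_pp k : size (cyclo_pp p k) = (p ^ k * p.-1).+1.
Proof.
have := congr1 (fun q : {poly rat} => size q) (cyclo_pp_mul p k).
have n0 : cyclo_pp p k != 0.
  apply/eqP => h; have := cyclo_pp_mul p k; rewrite h mulr0 => /esym/eqP.
  by rewrite -size_poly_eq0 size_XnsubC.
rewrite size_mul // -?size_poly_eq0 !size_XnsubC //= expnSr => h.
by apply/eqP; rewrite -(eqn_add2l (p ^ k)) h pred_pX addnS addnC.
Qed.

(** A root has order [p^e] for some [e <= k+1]; if [e <= k], every term takes the value 1 and the
    sum is [p], not 0. Conversely, a primitive root kills the product in [cyclo_pp_mul] but not its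
    factor [X^(p^k) - 1]. *)
Lemma root_cyclo_pp (K : numFieldType) k (w : K) :
  root (map_poly ratr (cyclo_pp p k)) w = (p ^ k.+1).-primitive_root w.
Proof.
have E : (map_poly ratr (cyclo_pp p k)).[w] = \sum_(j < p) w ^+ (p ^ k * j).
  rewrite /cyclo_pp rmorph_sum horner_sum; apply: eq_bigr => i _.
  by rewrite /= map_polyXn hornerXn.
have M : (w ^+ (p ^ k) - 1) * (map_poly ratr (cyclo_pp p k)).[w]
         = w ^+ (p ^ k.+1) - 1.
  rewrite E expnSr exprM [in RHS]subrX1; congr (_ * _).
  by apply: eq_bigr => i _; rewrite exprM.
apply/idP/idP => [/rootP h|h].
  rewrite h mulr0 in M; have w1 : w ^+ (p ^ k.+1) = 1.
    by apply/eqP; rewrite -subr_eq0 -M.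
  have [m mP] := prim_order_exists (pX_gt0 k.+1) w1.
  case/(dvdn_pfactor _ _ p_pr) => e; rewrite leq_eqVlt => /orP[/eqP -> <- //|].
  rewrite ltnS => ek mE; move: h; rewrite E.
  rewrite (eq_bigr (fun=> 1)) => [|i _].
    by rewrite sumr_const card_ord => /eqP; rewrite pnatr_eq0 eqn0Ngt p_gt0.
  rewrite exprM; suff -> : w ^+ (p ^ k) = 1 by rewrite expr1n.
  by apply/eqP; rewrite -(prim_order_dvd mP) mE dvdn_exp2l.
apply/rootP; move/eqP: M.
rewrite (prim_expr_order h) subrr mulf_eq0 => /orP[|/eqP //].
rewrite subr_eq0 -(prim_order_dvd h) dvdn_Pexp2l // ltnn //.
Qed.

(* A nonconstant common factor of [P] and the cyclotomic polynomial has a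
   root in [algC], whose minimal polynomial is the full cyclotomic one. *)
Lemma cyclo_pp_dvd (K : numFieldType) k (w : K) (P : {poly rat}) :
  (p ^ k.+1).-primitive_root w -> root (map_poly ratr P) w ->
  (cyclo_pp p k %| P)%R.
Proof.
move=> wP Pw; set F := cyclo_pp p k.
have n0 : F != 0 by rewrite -size_poly_eq0 size_cyclo_pp.
have Fw : root (map_poly ratr F) w by rewrite root_cyclo_pp.
have nc : ~~ coprimep P F.
  apply/negP; rewrite -(coprimep_map (@ratr K)) => cp.
  by have := coprimep_root cp Pw; rewrite (rootP Fw) eqxx.
set d := gcdp P F in nc.
have : size (map_poly (ratr : rat -> algC) d) != 1%N by rewrite size_map_poly.
case/closed_rootP => z dz.
have Fz : root (map_poly ratr F) z.
  by move: dz; apply: root_dvdp; rewrite dvdp_map dvdp_gcdr.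
rewrite root_cyclo_pp in Fz.
have [m [mE mmon] mP] := minCpolyP z.
rewrite mP in dz.
have sm : size m = size F.
  rewrite -(size_map_poly (ratr : {rmorphism rat -> algC})) -mE.
  rewrite (minCpoly_cyclotomic Fz) size_cyclotomic totient_pfactor //=.
  by rewrite size_cyclo_pp mulnC.
have d0 : d != 0 by rewrite gcdp_eq0 (negbTE n0) andbF.
have : (d %= F)%R.
  rewrite -dvdp_size_eqp ?dvdp_gcdr // eqn_leq dvdp_leq ?dvdp_gcdr //=.
  by rewrite -sm dvdp_leq.
by move/eqp_dvdl => <-; exact: dvdp_gcdl.
Qed.

(** The cyclotomic polynomial divides [P], the polynomial with coefficients [n r]. Multiplying by
    [X^(p^k) - 1] gives [(X^(p^k) - 1) P = Q (X^(p^(k+1)) - 1)] with [deg Q < p^k], so the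
    coefficient at [r + p^k] is zero. *)
Lemma vanishing_sum_periodic (K : numFieldType) k (w : K) (n : nat -> nat) :
  (p ^ k.+1).-primitive_root w ->
  \sum_(r < p ^ k.+1) (n r)%:R * w ^+ r = 0 ->
  forall r, (r + p ^ k < p ^ k.+1)%N -> n (r + p ^ k)%N = n r.
Proof.
move=> wP s0 r rlt.
pose P : {poly rat} := \poly_(i < p ^ k.+1) (n i)%:R.
have /(cyclo_pp_dvd wP)/dvdpP[Q QE] : root (map_poly ratr P) w.
  rewrite /P poly_def rmorph_sum /= /root horner_sum; apply/eqP.
  rewrite -[RHS]s0; apply: eq_bigr => i _.
  by rewrite map_polyZ /= ratr_nat map_polyXn hornerZ hornerXn.
have E : ('X^(p ^ k) - 1) * P = Q * ('X^(p ^ k.+1) - 1).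
  by rewrite QE -cyclo_pp_mul; ring.
have sQ : (size Q <= p ^ k)%N.
  have [->|Q0] := eqVneq Q 0; first by rewrite size_poly0.
  have : (size P <= p ^ k.+1)%N by exact: size_poly.
  rewrite QE size_mul // -?size_poly_eq0 size_cyclo_pp //= addnS /= expnSr.
  by rewrite pred_pX addnC leq_add2l.
have := congr1 (fun q : {poly rat} => q`_(r + p ^ k)) E.
rewrite /= mulrBl mulrBr mul1r mulr1 !coefB coefXnM coefMXn !coef_poly rlt.
rewrite ltnNge leq_addl /= addnK (nth_default 0); last by rewrite (leq_trans sQ) ?leq_addl.
rewrite (leq_ltn_trans _ rlt) ?leq_addr // subr0 => /eqP.
by rewrite subr_eq0 eqr_nat => /eqP.
Qed.

End PrimePower.

(** * Trees of residues *)

Section Tree.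
Variables (p : nat) (l : nat).
Hypothesis p_pr : prime p.

Let p_gt0 : (0 < p)%N. Proof. exact: prime_gt0. Qed.
Let pX_gt0 k : (0 < p ^ k)%N. Proof. by rewrite expn_gt0 p_gt0. Qed.

Implicit Types C : pred nat.

Definition cnt C (j r : nat) : nat :=
  (\sum_(c < p ^ l | C c && (c == r %[mod p ^ j])) 1)%N.

(** Invariance under the single shift [p^j] suffices: multiples of [p^j] permute transitively the
    [p] classes modulo [p^(j+1)] inside a class modulo [p^j]. *)
Definition equidistributed C (j : nat) : Prop :=
  forall r, cnt C j.+1 (r + p ^ j) = cnt C j.+1 r.

Definition one_child C (j : nat) : Prop :=
  forall c c', C c -> C c' -> c = c' %[mod p ^ j] -> c = c' %[mod p ^ j.+1].

Definition all_children C (j : nat) : Prop :=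
  forall c d, C c -> exists2 c', C c' & c' = (c + d * p ^ j)%N %[mod p ^ j.+1].

Definition n_equi C (j : nat) : nat := (\sum_(i < j) `[< equidistributed C i >])%N.

Lemma modn_expS j x :
  (x %% p ^ j.+1 = (x %/ p ^ j) %% p * p ^ j + x %% p ^ j)%N.
Proof.
rewrite {1}(divn_eq x (p ^ j)) {1}(divn_eq (x %/ p ^ j) p) mulnDl -mulnA -expnS.
rewrite -addnA modnMDl modn_small // expnS.
have := ltn_pmod (x %/ p ^ j) p_gt0; have := ltn_pmod x (pX_gt0 j).
nia.
Qed.

Lemma eqmod_expS j c r : (c == r %[mod p ^ j.+1]) =
  (c == r %[mod p ^ j]) && (c %/ p ^ j == r %/ p ^ j %[mod p]).
Proof.
apply/eqP/andP => [h|[/eqP h1 /eqP h2]]; last by rewrite !modn_expS h1 h2.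
have h1 : c = r %[mod p ^ j].
  by rewrite -(@modn_dvdm (p ^ j.+1) c) ?dvdn_exp2l // h modn_dvdm ?dvdn_exp2l.
split; apply/eqP => //; move: h; rewrite !modn_expS h1 => /eqP.
by rewrite eqn_add2r eqn_pmul2r // => /eqP.
Qed.

Lemma cnt_mod C j r r' : r = r' %[mod p ^ j] -> cnt C j r = cnt C j r'.
Proof. by move=> h; rewrite /cnt h. Qed.

Lemma unique_digit x y : (\sum_(d < p | x == y + d %[mod p]) 1 = 1)%N.
Proof.
have dlt : ((x + (p - y %% p)) %% p < p)%N by rewrite ltn_pmod.
rewrite (big_pred1 (Ordinal dlt)) // => d /=.
rewrite -val_eqE /= -[in RHS](modn_small (ltn_ord d)).
rewrite -(eqn_modDl (y %% p) d) addnCA subnKC; last by rewrite ltnW ?ltn_pmod.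
by rewrite modnDml eq_sym modnDr.
Qed.

Lemma cntS C j r : cnt C j r = (\sum_(d < p) cnt C j.+1 (r + d * p ^ j))%N.
Proof.
rewrite /cnt; rewrite (exchange_big_dep (fun c : 'I__ => C c && (c == r %[mod p ^ j]))) /=.
  apply: eq_bigr => c /andP[Cc h]; rewrite -[LHS](unique_digit (c %/ p ^ j) (r %/ p ^ j)).
  apply: eq_bigl => d; rewrite Cc /= eqmod_expS [(r + _)%N]addnC modnMDl h divnMDl //=.
  by rewrite [(d + _)%N]addnC.
move=> d c _ /andP[-> /=]; rewrite eqmod_expS => /andP[+ _].
by rewrite addnC modnMDl.
Qed.

Lemma cnt0 C r : cnt C 0 r = (\sum_(c < p ^ l | C c) 1)%N.
Proof. by apply: eq_bigl => c; rewrite !modn1 andbT. Qed.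

Lemma cnt_gt0 C j r :
  reflect (exists2 c, (c < p ^ l)%N && C c & c = r %[mod p ^ j]) (0 < cnt C j r)%N.
Proof.
rewrite lt0n /cnt sum_nat_eq0 negb_forall; apply: (iffP existsP) => [[c]|[c]].
  rewrite implybF negbK => /andP[Cc /eqP h].
  by exists c => //; rewrite ltn_ord.
move=> /andP[clt Cc] h; exists (Ordinal clt).
by rewrite implybF negbK /= Cc h eqxx.
Qed.

Lemma char_sum_cnt C j (F : fieldType) (w : F) : w ^+ (p ^ j) = 1 ->
  \sum_(c < p ^ l | C c) w ^+ c = \sum_(r < p ^ j) (cnt C j r)%:R * w ^+ r.
Proof.
move=> w1; under [RHS]eq_bigr do rewrite /cnt natr_sum mulr_suml.
rewrite [RHS](exchange_big_dep (fun c : 'I__ => C c)) /=; last by move=> ? ? _ /andP[].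
apply: eq_bigr => c Cc.
have clt : (c %% p ^ j < p ^ j)%N by rewrite ltn_pmod.
rewrite (big_pred1 (Ordinal clt)) /= ?mul1r ?expr_mod // => r /=.
by rewrite Cc /= [in LHS]eq_sym (modn_small (ltn_ord r)) -val_eqE.
Qed.

(** Shifting the residues by [p^j] preserves the counts and multiplies each power by [w^(p^j)],
    which is not 1. *)
Lemma equi_vanish C j (K : numFieldType) (w : K) :
  (p ^ j.+1).-primitive_root w -> equidistributed C j ->
  \sum_(c < p ^ l | C c) w ^+ c = 0.
Proof.
move=> wP eq; rewrite (char_sum_cnt C (prim_expr_order wP)).
pose g r : K := (cnt C j.+1 r)%:R * w ^+ r.
rewrite -[LHS]/(\sum_(r < p ^ j.+1) g r).
apply: (@eq_mul_fix0 _ (w ^+ (p ^ j))).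
  rewrite -(prim_order_dvd wP) dvdn_Pexp2l ?prime_gt1 // ltnn //.
rewrite -[LHS](@sum_shift_periodic _ g _ (p ^ j)) => [|c].
  rewrite mulr_sumr; apply: eq_bigr => r _.
  by rewrite /g eq exprD; ring.
by rewrite /g expr_mod ?(prim_expr_order wP) // (@cnt_mod C _ _ c) // modn_mod.
Qed.

Lemma vanish_equi C j (K : numFieldType) (w : K) :
  (p ^ j.+1).-primitive_root w ->
  \sum_(c < p ^ l | C c) w ^+ c = 0 -> equidistributed C j.
Proof.
move=> wP; rewrite (char_sum_cnt C (prim_expr_order wP)) => s0.
have H := vanishing_sum_periodic p_pr (n := cnt C j.+1) wP s0.
(* [H] compares [r] with [r + p^j] only without wraparound. Iterating it joins every residue modulo
   [p^(j+1)] to its residue modulo [p^j], which covers all shifts. *)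
have H1 s d : (s + d * p ^ j < p ^ j.+1)%N -> cnt C j.+1 (s + d * p ^ j) = cnt C j.+1 s.
  elim: d => [|d IH]; first by rewrite mul0n addn0.
  rewrite mulSn addnCA addnC => h; rewrite H // IH //.
  by apply: leq_ltn_trans h; rewrite leq_addr.
have H2 r : cnt C j.+1 r = cnt C j.+1 (r %% p ^ j)%N.
  rewrite (@cnt_mod C _ _ (r %% p ^ j.+1)%N); last by rewrite modn_mod.
  have e : (r %% p ^ j + r %% p ^ j.+1 %/ p ^ j * p ^ j = r %% p ^ j.+1)%N.
    by rewrite -(@modn_dvdm (p ^ j.+1) r (p ^ j)) ?dvdn_exp2l // addnC -divn_eq.
  by rewrite -e H1 // e ltn_pmod.
by move=> r; rewrite H2 modnDr -H2.
Qed.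

Lemma equi_cntS C j r : equidistributed C j -> cnt C j r = (p * cnt C j.+1 r)%N.
Proof.
move=> h; rewrite cntS (eq_bigr (fun=> cnt C j.+1 r)) ?sum_nat_const ?card_ord //.
move=> [d /= _] _; elim: d => [|d IH]; first by rewrite mul0n addn0.
by rewrite mulSn addnCA addnC h.
Qed.

Lemma cnt_leS C j r : (cnt C j.+1 r <= cnt C j r)%N.
Proof. by rewrite [leqRHS]cntS (bigD1 (Ordinal p_gt0)) //= mul0n addn0 leq_addr. Qed.

(** At an equidistributed level the count is divided by exactly [p] while the exponent gains one; at
    any other level the exponent stays and the count cannot grow. All the counting bounds rest on
    this monotonicity. *)
Lemma cnt_equi_step C j r :
  (cnt C j.+1 r * p ^ n_equi C j.+1 <= cnt C j r * p ^ n_equi C j)%N.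
Proof.
rewrite /n_equi big_ord_recr /=; case: asboolP => /= [h|_].
  by rewrite (equi_cntS r h) addn1 expnS mulnA [(cnt _ _ _ * p)%N]mulnC.
by rewrite addn0 leq_mul2r cnt_leS orbT.
Qed.

Lemma cnt_equi_le C i j r : (i <= j)%N ->
  (cnt C j r * p ^ n_equi C j <= cnt C i r * p ^ n_equi C i)%N.
Proof.
move=> /subnK <-; elim: (j - i)%N => [|k IH]; first by rewrite add0n.
by rewrite addSn (leq_trans (cnt_equi_step _ _ _)).
Qed.

Section Fixed.
Variable C : pred nat.
Hypothesis C_lt : forall c, C c -> (c < p ^ l)%N.

Lemma cnt_full c : C c -> cnt C l c = 1%N.
Proof.
move=> Cc; rewrite /cnt (big_pred1 (Ordinal (C_lt Cc))) // => d /=.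
rewrite (modn_small (ltn_ord d)) (modn_small (C_lt Cc)) -[RHS]val_eqE /=.
by case: eqP => [->|]; rewrite ?Cc ?andbF.
Qed.

Lemma n_equi_card c : C c ->
  (p ^ n_equi C l <= \sum_(c < p ^ l | C c) 1)%N.
Proof.
move=> Cc; have := cnt_equi_le C c (leq0n l).
by rewrite cnt_full // mul1n cnt0 {2}/n_equi big_ord0 expn0 muln1.
Qed.

(** In the equality case the product of the count and [p ^ n_equi] is constant along every branch,
    so at a level that is not equidistributed the count does not drop. *)
Lemma homogeneous_of_card j :
  (\sum_(c < p ^ l | C c) 1 <= p ^ n_equi C l)%N -> (j < l)%N ->
  one_child C j \/ all_children C j.
Proof.
move=> le jl; have [eq|neq] := pselect (equidistributed C j).
  right => c d Cc.
  have : (0 < cnt C j.+1 (c + d * p ^ j))%N.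
    elim: d => [|d IH]; last by rewrite mulSn addnCA addnC eq.
    by rewrite mul0n addn0; apply/cnt_gt0; exists c; rewrite ?C_lt.
  by case/cnt_gt0 => c' /andP[_ Cc'] h; exists c'.
left => c c' Cc Cc' cc'; apply/eqP.
have H : (cnt C j c <= cnt C j.+1 c)%N.
  have h1 := cnt_equi_le C c (leq0n j).
  rewrite cnt0 {2}/n_equi big_ord0 expn0 muln1 in h1.
  have h2 := leq_trans h1 le.
  have h3 := cnt_equi_le C c jl.
  rewrite cnt_full // mul1n in h3.
  have := leq_trans h2 h3; rewrite {2}/n_equi big_ord_recr /=.
  by rewrite asboolF // addn0 leq_pmul2r.
(* A second child of the class of [c], containing [c'], would be counted at level [j] but not at
   [j.+1], making the count drop. *)
apply: contraT => ne; move: H; rewrite leqNgt => /negP[].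
rewrite /cnt [ltnRHS](bigD1 (Ordinal (C_lt Cc'))) /=; last by rewrite Cc' cc' eqxx.
rewrite add1n ltnS big_mkcond [leqRHS]big_mkcond /=; apply: leq_sum => d _.
case: ifP => // /andP[Cd h]; rewrite Cd -val_eqE /=.
have -> : (d == c %[mod p ^ j]) by move: h; rewrite eqmod_expS => /andP[].
have -> : (d != c' :> nat)%N by apply: contraTneq h => ->; rewrite eq_sym.
by [].
Qed.

Hypothesis hom : forall j, (j < l)%N -> one_child C j \/ all_children C j.

(** Downward induction from the leaves, where the count is 1: a one-child level keeps the common
    count and a full level multiplies it by [p]. *)
Lemma homogeneous_cnt j : (j <= l)%N ->
  exists h, forall c, C c -> cnt C j c = h.
Proof.
move=> /subKn <-; elim: (l - j)%N (leq_subr j l) => [|k IH] kl.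
  by exists 1%N => c Cc; rewrite subn0 cnt_full.
have [h hP] := IH (ltnW kl).
have [A|B] := @hom (l - k.+1)%N ltac:(lia).
  exists h => c Cc; rewrite -(hP c Cc); have -> : (l - k = (l - k.+1).+1)%N by lia.
  apply: eq_bigl => d; case Cd : (C d) => //=.
  apply/eqP/eqP => [|/eqP]; first exact: A.
  by rewrite eqmod_expS => /andP[/eqP].
exists (p * h)%N => c Cc; rewrite cntS -[X in (X * h)%N]card_ord -sum_nat_const.
apply: eq_bigr => d _; have [c' Cc' e] := B c d Cc.
rewrite -(hP c' Cc'); have -> : (l - k = (l - k.+1).+1)%N by lia.
exact/esym/cnt_mod.
Qed.

(** Nonempty classes modulo [p^(j+1)] all have the count [h]. As [r] and [r + p^j] lie in one class
    modulo [p^j], their classes modulo [p^(j+1)] are both nonempty or both empty. *)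
Lemma all_children_equi j : (j < l)%N -> all_children C j -> equidistributed C j.
Proof.
move=> jl B r; have [h hP] := homogeneous_cnt jl.
have ch c s : C c -> s = c %[mod p ^ j] -> cnt C j.+1 s = h.
  move=> Cc e.
  have [d _ /eqP dP] : exists2 d, (d < p)%N & s %/ p ^ j == c %/ p ^ j + d %[mod p].
    have := unique_digit (s %/ p ^ j) (c %/ p ^ j).
    case: (pickP (fun d : 'I_p => s %/ p ^ j == c %/ p ^ j + d %[mod p])) => [d hd _|h0].
      by exists d.
    by rewrite big_pred0.
  have [c' Cc' e'] := B c d Cc.
  rewrite -(hP c' Cc'); apply: cnt_mod; apply/eqP; rewrite e' eqmod_expS.
  by rewrite [(c + _)%N]addnC modnMDl divnMDl // e eqxx /= [(d + _)%N]addnC dP.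
have z s : ~ (exists2 c, C c & s = c %[mod p ^ j]) -> cnt C j.+1 s = 0%N.
  move=> N; apply/eqP; rewrite eqn0Ngt; apply/negP => /cnt_gt0[c /andP[_ Cc] /eqP].
  rewrite eqmod_expS => /andP[/eqP e _]; apply: N; exists c => //.
have [[c Cc e]|N] := pselect (exists2 c, C c & r = c %[mod p ^ j]).
  by rewrite !(ch c) // modnDr.
by rewrite !z // => -[c Cc]; rewrite modnDr => e; apply: N; exists c.
Qed.

End Fixed.

End Tree.

(** * Orthogonality of characters of the cyclic group of order [p^l] *)

Section Duality.
Variables (p l : nat).
Hypothesis p_pr : prime p.

Let p_gt0 : (0 < p)%N. Proof. exact: prime_gt0. Qed.
Let pX_gt0 k : (0 < p ^ k)%N. Proof. by rewrite expn_gt0 p_gt0. Qed.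

Implicit Types C T Y : pred nat.

Lemma first_diff y y' : (y < p ^ l)%N -> (y' < p ^ l)%N -> y != y' ->
  exists v, [/\ (v < l)%N, y == y' %[mod p ^ v] & y != y' %[mod p ^ v.+1]].
Proof.
move=> yl yl' ne.
have ex : exists v, y != y' %[mod p ^ v] by exists l; rewrite !modn_small.
case: (ex_minnP ex) => -[|v]; first by rewrite !modn1.
move=> h m; exists v; split=> //.
  have := m l; rewrite !modn_small // => /(_ ne).
  by [].
by apply: contraT => /m; rewrite ltnn.
Qed.

(** [z^(y - y')] has order [p^l / gcd(y - y', p^l)], and the gcd is [p^v] when [v] is the first
    differing digit. The order [p^(l - v)] is written with a successor exponent to exhibit the dual
    level [l - v.+1]. *)
Lemma prim_root_ratio (K : fieldType) (z : K) y y' v :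
  (p ^ l).-primitive_root z -> (v < l)%N ->
  y == y' %[mod p ^ v] -> y != y' %[mod p ^ v.+1] ->
  (p ^ (l - v.+1).+1).-primitive_root (z ^+ y / z ^+ y').
Proof.
(* [k] is a natural number congruent to [y - y'] modulo [p^l]. *)
move=> zP vl e ne; pose k := (y + (p ^ l).-1 * y')%N.
have z0 : z ^+ y' != 0.
  apply/eqP => h; have := congr1 (fun x => x ^+ (p ^ l)) h.
  rewrite -exprM mulnC exprM (prim_expr_order zP) expr1n expr0n.
  by rewrite eqn0Ngt pX_gt0 => /eqP; rewrite oner_eq0.
have kE : (k + y' = y' * p ^ l + y)%N.
  by rewrite /k -addnA -mulSnr prednK // addnC mulnC.
have -> : z ^+ y / z ^+ y' = z ^+ k.
  apply: (mulIf z0); rewrite divfK // -exprD kE exprD mulnC exprM.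
  by rewrite (prim_expr_order zP) expr1n mul1r.
have kP i : (i <= l)%N -> (p ^ i %| k)%N = (y == y' %[mod p ^ i]).
  move=> il; have d : (p ^ i %| p ^ l)%N by rewrite dvdn_exp2l.
  rewrite /dvdn -(mod0n (p ^ i)) -(eqn_modDr y') kE add0n.
  by rewrite -(subnK il) expnD mulnA modnMDl.
have := exp_prim_root zP k.
suff -> : gcdn k (p ^ l) = (p ^ v)%N.
  by rewrite -expnB ?p_gt0 // ?(ltnW vl) // subnSK.
have := dvdn_gcdr k (p ^ l); case/(dvdn_pfactor _ _ p_pr) => i il gE.
have vi : (v <= i)%N.
  have : (p ^ v %| gcdn k (p ^ l))%N by rewrite dvdn_gcd kP ?(ltnW vl) // e dvdn_exp2l // ltnW.
  by rewrite gE dvdn_Pexp2l ?prime_gt1.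
rewrite gE; congr (_ ^ _)%N; apply/eqP; rewrite eqn_leq vi andbT leqNgt.
apply: contraNN ne => vi'; rewrite -kP //.
by apply: dvdn_trans (dvdn_gcdl k (p ^ l)); rewrite gE dvdn_exp2l.
Qed.

(* Frequencies in [Y] are separated by their digits dual to the levels where
   [C] is equidistributed. *)
Lemma orthogonal_card C Y :
  (forall y y' v, Y y -> Y y' -> (v < l)%N ->
     y == y' %[mod p ^ v] -> y != y' %[mod p ^ v.+1] ->
     equidistributed p l C (l - v.+1)) ->
  (\sum_(y < p ^ l | Y y) 1 <= p ^ n_equi p l C l)%N.
Proof.
move=> H; rewrite sum1_card /n_equi.
pose E (j : 'I_l) := `[< equidistributed p l C j >].
have -> : (\sum_(i < l) E i = #|{: {j : 'I_l | E j}}|)%N.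
  by rewrite card_sig -sum1_card [RHS]big_mkcond; apply: eq_bigr => i _; rewrite inE; case: (E i).
have -> : (p ^ #|{: {j : 'I_l | E j}}| = #|{: {ffun {j : 'I_l | E j} -> 'I_p}}|)%N.
  by rewrite card_ffun card_ord.
pose f (y : 'I_(p ^ l)) : {ffun {j : 'I_l | E j} -> 'I_p} :=
  [ffun j : {j : 'I_l | E j} => Ordinal (ltn_pmod (y %/ p ^ (l - (val j).+1)) p_gt0)].
apply: (@leq_card_in _ _ f) => y y' Yy Yy' /ffunP fE.
apply/val_inj/eqP; apply: contraT => ne.
(* The first differing digit [v] sits opposite the equidistributed level [l - v.+1], so [f] records
   it and separates [y] from [y']. *)
have [v [vl e nv]] := first_diff (ltn_ord y) (ltn_ord y') ne.
have jl : (l - v.+1 < l)%N by rewrite ltn_subrL (leq_trans _ vl).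
have Ej : E (Ordinal jl) by apply/asboolP => /=; apply: H e nv.
have := congr1 val (fE (exist (fun j => is_true (E j)) _ Ej)); rewrite !ffunE /=.
have -> : (l - (l - v.+1).+1 = v)%N by lia.
by move=> /eqP d; move: nv; rewrite eqmod_expS // e d.
Qed.

(** By [vanish_equi], two frequencies first differing at digit [v] make level [l - v.+1]
    equidistributed. Hence [|C| <= |Y| <= p ^ n_equi], the equality case of
    [homogeneous_of_card]. *)
Lemma homogeneous_of_orthogonal C Y (K : numFieldType) (z : K) :
  (forall c, C c -> (c < p ^ l)%N) ->
  (p ^ l).-primitive_root z ->
  (forall y y', Y y -> Y y' -> y != y' ->
     \sum_(c < p ^ l | C c) (z ^+ y / z ^+ y') ^+ c = 0) ->
  (\sum_(c < p ^ l | C c) 1 <= \sum_(y < p ^ l | Y y) 1)%N ->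
  forall j, (j < l)%N -> one_child p C j \/ all_children p C j.
Proof.
move=> Clt zP orth le j jl; apply: (homogeneous_of_card p_pr Clt _ jl).
apply: (leq_trans le); apply: orthogonal_card => y y' v Yy Yy' vl e ne.
apply: (vanish_equi p_pr (prim_root_ratio zP vl e ne)); apply: orth => //.
by apply: contraNN ne => /eqP ->.
Qed.

(** If [y] and [y'] first differ at digit [v], then [Y] is not one-child there, so [C] is full at
    the dual level, hence equidistributed. The lemma is applied twice, with the two sets
    exchanged. *)
Lemma dual_orthogonal C Y (K : numFieldType) (z : K) :
  (forall c, C c -> (c < p ^ l)%N) -> (forall y, Y y -> (y < p ^ l)%N) ->
  (p ^ l).-primitive_root z ->
  (forall j, (j < l)%N -> one_child p C j \/ all_children p C j) ->
  (forall v, (v < l)%N -> one_child p Y v \/ all_children p C (l - v.+1)) ->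
  forall y y', Y y -> Y y' -> y != y' ->
    \sum_(c < p ^ l | C c) (z ^+ y / z ^+ y') ^+ c = 0.
Proof.
move=> Clt Ylt zP hom H y y' Yy Yy' ne.
have [v [vl e nv]] := first_diff (Ylt _ Yy) (Ylt _ Yy') ne.
apply: (equi_vanish p_pr (prim_root_ratio zP vl e nv)).
have jl : (l - v.+1 < l)%N by rewrite ltn_subrL (leq_trans _ vl).
apply: (all_children_equi p_pr Clt hom jl).
case: (H v vl) => // one; move/negP: nv; case; apply/eqP/one => //.
exact/eqP.
Qed.

(** * Tilings of the cyclic group of order [p^l] *)

Section Tiling.
Variables C T : pred nat.
Hypothesis C_lt : forall c, C c -> (c < p ^ l)%N.
Hypothesis T_lt : forall t, T t -> (t < p ^ l)%N.
Hypothesis cover : forall x, (x < p ^ l)%N ->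
  exists c t, [/\ C c, T t & (c + t) %% p ^ l = x]%N.
Hypothesis disj : forall c t c' t', C c -> T t -> C c' -> T t' ->
  c + t = c' + t' %[mod p ^ l] -> c = c' /\ t = t'.

(** Each residue [x] is [c + t] modulo [p^l] for exactly one pair, so the expanded product runs once
    through all powers. *)
Lemma tiling_char_mul (F : fieldType) (w : F) : w ^+ (p ^ l) = 1 ->
  (\sum_(c < p ^ l | C c) w ^+ c) * (\sum_(t < p ^ l | T t) w ^+ t)
  = \sum_(x < p ^ l) w ^+ x.
Proof.
move=> w1; rewrite big_distrlr /= pair_big /=.
transitivity (\sum_(u : 'I_(p ^ l) * 'I_(p ^ l) | C u.1 && T u.2)
   \sum_(x < p ^ l | ((u.1 + u.2) %% p ^ l)%N == x :> nat) w ^+ x).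
  apply: eq_bigr => u _; have xl : ((u.1 + u.2) %% p ^ l < p ^ l)%N by rewrite ltn_pmod.
  by rewrite (big_pred1 (Ordinal xl)) /= ?expr_mod ?exprD.
rewrite (exchange_big_dep predT) //=; apply: eq_bigr => x _.
have [c [t [Cc Tt ctx]]] := cover (ltn_ord x).
rewrite (big_pred1 (Ordinal (C_lt Cc), Ordinal (T_lt Tt))) //= => -[c' t'] /=.
apply/andP/eqP => [[/andP[Cc' Tt'] /eqP e]|[-> ->]] /=; last by rewrite Cc Tt ctx.
have [ec et] := disj Cc' Tt' Cc Tt (etrans e (esym ctx)).
by congr pair; apply: val_inj.
Qed.

Lemma homogeneous_of_tiling j : (j < l)%N -> one_child p C j \/ all_children p C j.
Proof.
move=> jl; apply: (homogeneous_of_card p_pr C_lt _ jl).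
have [c0 [t0 [Cc0 Tt0 _]]] := cover (pX_gt0 l).
(* The character identity at [w = 1] counts elements. *)
have cardM : ((\sum_(c < p ^ l | C c) 1) * (\sum_(t < p ^ l | T t) 1) = p ^ l)%N.
  apply/eqP; rewrite -(eqr_nat rat) natrM !natr_sum; apply/eqP.
  have := @tiling_char_mul rat 1 (expr1n _ _).
  rewrite (eq_bigr (fun=> 1)) => [|i _]; last by rewrite expr1n.
  rewrite [X in _ * X](eq_bigr (fun=> 1)) => [|i _]; last by rewrite expr1n.
  rewrite [X in _ = X](eq_bigr (fun=> 1)) => [|i _]; last by rewrite expr1n.
  by move=> ->; rewrite sumr_const card_ord.
have [z zP] := C_prim_root_exists (pX_gt0 l).
have E i : (i < l)%N ->
    (1 <= `[< equidistributed p l C i >] + `[< equidistributed p l T i >])%N.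
  move=> il.
  have wP : (p ^ i.+1).-primitive_root (z ^+ (p ^ l %/ p ^ i.+1)).
    by apply: dvdn_prim_root => //; rewrite dvdn_exp2l.
  move: wP; set w := z ^+ _ => wP.
  have wl : w ^+ (p ^ l) = 1.
    by apply/eqP; rewrite -(prim_order_dvd wP) dvdn_exp2l.
  have := tiling_char_mul wl.
  (* The sum over the whole group is invariant under multiplication by [w], hence zero. *)
  have -> : \sum_(x < p ^ l) w ^+ x = 0.
    apply: (@eq_mul_fix0 _ w).
      by apply: (prim_root_neq1 _ wP); rewrite -(expn0 p) ltn_exp2l ?prime_gt1.
    rewrite -[LHS](@sum_shift_periodic _ (fun x => w ^+ x) _ 1) => [|c].
      by rewrite mulr_sumr; apply: eq_bigr => x _; rewrite addn1 exprS.
    by rewrite expr_mod.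
  move/eqP; rewrite mulf_eq0 => /orP[] /eqP /(vanish_equi p_pr wP) h.
    by rewrite [X in (nat_of_bool X + _)%N]asboolT.
  by rewrite [X in (_ + nat_of_bool X)%N]asboolT // addn1.
have le : (l <= n_equi p l C l + n_equi p l T l)%N.
  rewrite /n_equi -big_split /= -[leqLHS]card_ord -sum1_card.
  by apply: leq_sum => i _; exact: E.
have h2 := n_equi_card p_pr T_lt Tt0.
have T0 : (0 < p ^ n_equi p l T l)%N by [].
(* With [n_C] and [n_T] the numbers of equidistributed levels, [|C| p^(n_T) <= |C| |T| = p^l <=
   p^(n_C + n_T)]; cancel [p^(n_T)]. *)
rewrite -(leq_pmul2r T0) -expnD; apply: leq_trans (_ : p ^ l <= _)%N.
  by rewrite -[leqRHS]cardM leq_mul2l h2 orbT.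
by rewrite leq_exp2l ?prime_gt1.
Qed.

End Tiling.
End Duality.

(** * Arithmetic of digit expansions *)

(** The base case is a whole half-line because digits and truncations vanish below some position
    depending on the number. *)
Lemma int_up_ind (a : int) (Q : int -> Prop) :
  (forall n, n <= a -> Q n) -> (forall n, a <= n -> Q n -> Q (n + 1)) ->
  forall n, Q n.
Proof.
move=> Q0 QS n; have [/Q0//|/ltW an] := leP n a.
have -> : n = a + `|n - a|%N%:Z by lia.
elim: `|n - a|%N => [|k IH]; first by rewrite addr0; apply: Q0.
by rewrite -addn1 PoszD addrA; apply: QS => //; rewrite lerDl.
Qed.

Section QpArith.
Variable p : nat.
Hypothesis p_pr : prime p.

Let p_gt0 : (0 < p)%N. Proof. exact: prime_gt0. Qed.
Let P : rat := p%:R.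
Let P_gt0 : 0 < P. Proof. by rewrite ltr0n. Qed.
Let P_neq0 : P != 0. Proof. by rewrite gt_eqF. Qed.
Let PX_gt0 n : 0 < P ^ n. Proof. exact: exprz_gt0. Qed.
Let PXS n : P ^ (n + 1) = P ^ n * P. Proof. by rewrite expfzDr // expr1z. Qed.

(* [q] belongs to [p^n Z] (not merely to [p^n Z_(p)]). *)
Definition pdiv_by (n : int) (q : rat) : Prop := exists z : int, q = z%:~R * p%:R ^ n.

Lemma pdiv0 n : pdiv_by n 0.
Proof. by exists 0; rewrite mul0r. Qed.

Lemma pdivD n q r : pdiv_by n q -> pdiv_by n r -> pdiv_by n (q + r).
Proof. by move=> [u ->] [v ->]; exists (u + v); rewrite rmorphD mulrDl. Qed.

Lemma pdivN n q : pdiv_by n q -> pdiv_by n (- q).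
Proof. by move=> [u ->]; exists (- u); rewrite rmorphN mulNr. Qed.

Lemma pdivB n q r : pdiv_by n q -> pdiv_by n r -> pdiv_by n (q - r).
Proof. by move=> h /pdivN; apply: pdivD. Qed.

Lemma pdivM m n q r : pdiv_by m q -> pdiv_by n r -> pdiv_by (m + n) (q * r).
Proof.
move=> [u ->] [v ->]; exists (u * v); rewrite rmorphM expfzDr //.
by rewrite !mulrA; congr (_ * _); rewrite mulrAC.
Qed.

Lemma pdivW m n q : m <= n -> pdiv_by n q -> pdiv_by m q.
Proof.
move=> mn [u ->]; exists (u * p%:Z ^+ `|n - m|%N).
rewrite rmorphM rmorphXn /= -mulrA; congr (_ * _).
rewrite exprnP gez0_abs ?subr_ge0 // -(expfzDr (n - m) m P_neq0).
by rewrite subrK.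
Qed.

Lemma pdiv_nat n (d : nat) : pdiv_by n (d%:R * p%:R ^ n).
Proof. by exists d. Qed.

Lemma pdiv_small n s t : 0 <= s < p%:R ^ n -> 0 <= t < p%:R ^ n ->
  pdiv_by n (s - t) -> s = t.
Proof.
move=> /andP[s0 s1] /andP[t0 t1] [z zE].
suff : z = 0 by move=> z0; apply/eqP; rewrite -subr_eq0 zE z0 mul0r.
have h1 : `|s - t| < p%:R ^ n by rewrite ltr_norml; apply/andP; split; lra.
rewrite zE normrM (gtr0_norm (PX_gt0 n)) gtr_pMl // -intr_norm in h1.
by rewrite -[1]/(1%:~R) ltr_int in h1; lia.
Qed.

Lemma lbP (x : Qp p) n : n < lb x -> dig x n = 0%N.
Proof. exact: (proj2_sig (cid (dig_lb x))). Qed.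

Lemma trunc_low (x : Qp p) n : n <= lb x -> trunc x n = 0.
Proof. by move=> h; rewrite /trunc ltNge h /= big_ord0. Qed.

Lemma truncS (x : Qp p) n : trunc x (n + 1) = trunc x n + (dig x n)%:R * p%:R ^ n.
Proof.
have [h|h] := ltP n (lb x).
  by rewrite lbP // mul0r addr0 !trunc_low //; lia.
rewrite /trunc.
have -> : (if lb x < n + 1 then `|(n + 1)%R - lb x|%N else 0%N) = `|n - lb x|%N.+1.
  by rewrite ltzD1 h; lia.
have -> : (if lb x < n then `|n - lb x|%N else 0%N) = `|n - lb x|%N.
  by case: ltP => //; lia.
rewrite big_ord_recr /=; congr (_ + _).
have -> : lb x + `|n - lb x|%N%:Z = n by lia.
by [].
Qed.

Lemma trunc_itv (x : Qp p) n : 0 <= trunc x n < p%:R ^ n.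
Proof.
move: n; apply: (@int_up_ind (lb x)) => [n /trunc_low ->|n _ /andP[h0 h1]].
  by rewrite lexx PX_gt0.
rewrite truncS PXS; apply/andP; split.
  by rewrite addr_ge0 // mulr_ge0 // ltW // PX_gt0.
have : (dig x n)%:R <= P - 1.
  by rewrite lerBrDr -[1]/(1%:R) -natrD ler_nat addn1 dig_lt.
have := PX_gt0 n; rewrite -/P in h1 *; nra.
Qed.

Lemma trunc_le (x : Qp p) m n : m <= n -> pdiv_by m (trunc x n - trunc x m).
Proof.
move: n; apply: (@int_up_ind m) => [n h1 h2|n mn IH _].
  have -> : n = m by apply/eqP; rewrite eq_le h1.
  by rewrite subrr; apply: pdiv0.
rewrite truncS addrAC; apply: pdivD; first exact: IH.
by apply: pdivW mn _; apply: pdiv_nat.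
Qed.

(** Congruence modulo [p^n Z_p], expressed on digits; [eqmP] turns it into a divisibility between
    rational truncations, where the arithmetic is done. *)
Definition eqm (n : int) (x y : Qp p) : Prop := forall k, k < n -> dig x k = dig y k.

Lemma eqm_sym n x y : eqm n x y -> eqm n y x.
Proof. by move=> h k kn; rewrite h. Qed.
Lemma eqm_trans n y x z : eqm n x y -> eqm n y z -> eqm n x z.
Proof. by move=> h1 h2 k kn; rewrite h1 ?h2. Qed.
Lemma eqmW m n x y : m <= n -> eqm n x y -> eqm m x y.
Proof. by move=> mn h k km; apply: h; apply: lt_le_trans km mn. Qed.
Lemma eqmS n x y : eqm n x y -> dig x n = dig y n -> eqm (n + 1) x y.
Proof.
move=> h e k; rewrite ltzD1 le_eqVlt => /orP[/eqP ->//|]; exact: h.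
Qed.

Lemma eqm_trunc n x y : eqm n x y -> trunc x n = trunc y n.
Proof.
move: n; apply: (@int_up_ind (Num.min (lb x) (lb y))) => [n|n _ IH].
  by rewrite le_min => /andP[h1 h2] _; rewrite !trunc_low.
move=> h; rewrite !truncS IH; last by apply: eqmW h; rewrite lerDl.
by rewrite h // ltrDl.
Qed.

(** Truncations at [n] and at [k <= n] differ by multiples of [p^k], so the congruence descends to
    every [k], where [pdiv_small] makes it an equality; consecutive truncations then give the
    digits. *)
Lemma eqmP n x y : eqm n x y <-> pdiv_by n (trunc x n - trunc y n).
Proof.
split=> [/eqm_trunc ->|h]; first by rewrite subrr; apply: pdiv0.
have E k : k <= n -> trunc x k = trunc y k.
  move=> kn; apply: (@pdiv_small k); rewrite ?trunc_itv //.
  have -> : trunc x k - trunc y k = (trunc x n - trunc y n)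
     - (trunc x n - trunc x k) + (trunc y n - trunc y k) by lra.
  apply: pdivD; last exact: trunc_le.
  by apply: pdivB; [exact: pdivW h|exact: trunc_le].
move=> k kn; have := E (k + 1); rewrite -ltzD1 ltrD2r => /(_ kn).
rewrite !truncS E ?(ltW kn) // => /addrI /(mulIf (lt0r_neq0 (PX_gt0 k))) /eqP.
by rewrite eqr_nat => /eqP.
Qed.

Lemma Qp_ext (x y : Qp p) : (forall n, eqm n x y) -> x = y.
Proof.
move=> h; have e : dig x = dig y by apply/funext => k; apply: (h (k + 1)); rewrite ltrDl.
case: x y e {h} => [f f1 f2] [g g1 g2] /= e; subst g.
by congr MkQp; exact: Prop_irrelevance.
Qed.

Lemma trunc_qp0 n : trunc (qp0 p) n = 0.
Proof. by rewrite /trunc big1 // => i _; rewrite mul0r. Qed.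

Lemma pZ_eqm n (x : Qp p) : pZ n x <-> eqm n x (qp0 p).
Proof. by []. Qed.

Lemma pZ_trunc_low n m (x : Qp p) : pZ n x -> m <= n -> trunc x m = 0.
Proof.
move=> h mn; rewrite (@eqm_trunc m x (qp0 p)) ?trunc_qp0 //.
exact: eqmW mn (proj1 (pZ_eqm _ _) h).
Qed.

Lemma pZ_pdiv n m (x : Qp p) : pZ n x -> pdiv_by n (trunc x m).
Proof.
move=> h; have [mn|nm] := leP m n.
  by rewrite (pZ_trunc_low h mn); apply: pdiv0.
have := trunc_le x (ltW nm); by rewrite (pZ_trunc_low h (lexx n)) subr0.
Qed.

Lemma pZ_lb (x : Qp p) : pZ (lb x) x.
Proof. by move=> k; apply: lbP. Qed.

(** Shared correctness proof for [qadd], [qopp] and [qmul], which all read digit [n] off a rational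
    approximation [q (n + 1)]: the approximations are coherent, so the truncations of the result are
    congruent to them. *)
Lemma trunc_mkQp (L : int) (q : int -> rat) :
  (forall n, 0 <= q n) -> (forall n, n <= L -> pdiv_by n (q n)) ->
  (forall n, pdiv_by n (q (n + 1) - q n)) ->
  forall n, pdiv_by n (trunc (mkQp p L (fun n => digat p (q (n + 1)) n)) n - q n).
Proof.
move=> q0 qL qS; set x := mkQp _ _ _.
have xL : pZ L x by move=> k kL /=; rewrite kL.
apply: (@int_up_ind L) => [n nL|n Ln IH].
  by rewrite (pZ_trunc_low xL nL) sub0r; apply/pdivN/qL.
have [z zE] : pdiv_by n (q (n + 1) - trunc x n).
  have -> : q (n + 1) - trunc x n = (q (n + 1) - q n) - (trunc x n - q n) by lra.
  by apply: pdivB.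
have qE : q (n + 1) = z%:~R * P ^ n + trunc x n by rewrite -zE subrK.
have /andP[t0 t1] := trunc_itv x n.
have fl : Num.floor (q (n + 1) / P ^ n) = z.
  apply: floor_def; rewrite qE mulrDl mulfK ?gt_eqF //.
  rewrite lerDl divr_ge0 // ?(ltW (PX_gt0 n)) //= intrD ltrD2l.
  by rewrite ltr_pdivrMr // mul1r.
(* [digat] takes the absolute value of the floor, so the sign of [z] matters. *)
have z0 : 0 <= z.
  by rewrite -fl floor_ge0 divr_ge0 // ltW.
case: z z0 qE fl {zE} => // m _ qE fl.
rewrite truncS /= ltNge Ln /= /digat fl /= modn_mod qE.
have -> : trunc x n + (m %% p)%:R * P ^ n - (m%:~R * P ^ n + trunc x n)
   = ((m %% p)%:R - m%:R) * P ^ n by rewrite -pmulrn; ring.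
exists (- (m %/ p)%N%:Z); rewrite PXS {2}(divn_eq m p) natrD natrM rmorphN /=.
by rewrite -/P -pmulrn; ring.
Qed.

Lemma trunc_add (x y : Qp p) n :
  pdiv_by n (trunc (qadd x y) n - (trunc x n + trunc y n)).
Proof.
apply: (@trunc_mkQp _ (fun n => trunc x n + trunc y n)) => {}n.
- by have /andP[h _] := trunc_itv x n; have /andP[h' _] := trunc_itv y n; rewrite addr_ge0.
- rewrite le_min => /andP[h1 h2]; rewrite !trunc_low // addr0; exact: pdiv0.
- have -> : trunc x (n + 1) + trunc y (n + 1) - (trunc x n + trunc y n)
    = (trunc x (n + 1) - trunc x n) + (trunc y (n + 1) - trunc y n) by lra.
  by apply: pdivD; apply: trunc_le; rewrite lerDl.
Qed.

Lemma trunc_opp (x : Qp p) n : pdiv_by n (trunc (qopp x) n + trunc x n).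
Proof.
have Pn k : pdiv_by k (P ^ k) by exists 1; rewrite mul1r.
have -> : trunc (qopp x) n + trunc x n
   = (trunc (qopp x) n - (P ^ n - trunc x n)) + P ^ n by lra.
apply: pdivD => //.
apply: (@trunc_mkQp _ (fun n => P ^ n - trunc x n)) => {}n.
- by have /andP[_ h] := trunc_itv x n; rewrite subr_ge0 ltW.
- by move=> h; rewrite trunc_low // subr0.
- have -> : P ^ (n + 1) - trunc x (n + 1) - (P ^ n - trunc x n)
    = P ^ (n + 1) - P ^ n - (trunc x (n + 1) - trunc x n) by lra.
  apply: pdivB; last by apply: trunc_le; rewrite lerDl.
  by apply: pdivB => //; apply: pdivW (Pn _); rewrite lerDl.
Qed.

Lemma trunc_sub (x y : Qp p) n :
  pdiv_by n (trunc (qsub x y) n - (trunc x n - trunc y n)).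
Proof.
have -> : trunc (qsub x y) n - (trunc x n - trunc y n) =
  (trunc (qsub x y) n - (trunc x n + trunc (qopp y) n)) + (trunc (qopp y) n + trunc y n) by lra.
by apply: pdivD; [apply: trunc_add|apply: trunc_opp].
Qed.

(** Cutting [x] at [n - lb y] costs an error divisible by [p^(n - lb y)], and [y] contributes a
    factor [p^(lb y)]; symmetrically for [y]. So the approximations in [qmul] are coherent modulo
    [p^n]. *)
Lemma trunc_mul (x y : Qp p) n :
  pdiv_by n (trunc (qmul x y) n - trunc x (n - lb y) * trunc y (n - lb x)).
Proof.
pose q m := trunc x (m - lb y) * trunc y (m - lb x).
have -> : qmul x y = mkQp p (lb x + lb y) (fun n => digat p (q (n + 1)) n) by [].
rewrite -/(q n); apply: trunc_mkQp => {}n; rewrite /q.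
- have /andP[h _] := trunc_itv x (n - lb y); have /andP[h' _] := trunc_itv y (n - lb x).
  by rewrite mulr_ge0.
- move=> h; rewrite trunc_low ?mul0r; first exact: pdiv0.
  by rewrite lerBlDr.
- have ex : n + 1 - lb y = n - lb y + 1 by lia.
  have ey : n + 1 - lb x = n - lb x + 1 by lia.
  have -> : trunc x (n + 1 - lb y) * trunc y (n + 1 - lb x)
       - trunc x (n - lb y) * trunc y (n - lb x) =
    (trunc x (n - lb y + 1) - trunc x (n - lb y)) * trunc y (n - lb x + 1)
    + (trunc y (n - lb x + 1) - trunc y (n - lb x)) * trunc x (n - lb y).
    by rewrite ex ey; ring.
  apply: pdivD.
    rewrite -[X in pdiv_by X](subrK (lb y)); apply: (@pdivM (n - lb y) (lb y)); last by apply: pZ_pdiv; apply: pZ_lb.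
    by apply: trunc_le; rewrite lerDl.
  rewrite -[X in pdiv_by X](subrK (lb x)); apply: (@pdivM (n - lb x) (lb x)); last by apply: pZ_pdiv; apply: pZ_lb.
  by apply: trunc_le; rewrite lerDl.
Qed.

Lemma eqm_subP n (x t w : Qp p) :
  eqm n (qsub x t) w <-> pdiv_by n (trunc x n - trunc t n - trunc w n).
Proof.
rewrite eqmP; have h := trunc_sub x t n; split=> h'.
  have -> : trunc x n - trunc t n - trunc w n = (trunc (qsub x t) n - trunc w n)
     - (trunc (qsub x t) n - (trunc x n - trunc t n)) by lra.
  exact: pdivB.
have -> : trunc (qsub x t) n - trunc w n = trunc x n - trunc t n - trunc w n
     + (trunc (qsub x t) n - (trunc x n - trunc t n)) by lra.
exact: pdivD.
Qed.

Lemma eqm_addP n (x t w : Qp p) :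
  eqm n (qadd x t) w <-> pdiv_by n (trunc x n + trunc t n - trunc w n).
Proof.
rewrite eqmP; have h := trunc_add x t n; split=> h'.
  have -> : trunc x n + trunc t n - trunc w n = (trunc (qadd x t) n - trunc w n)
     - (trunc (qadd x t) n - (trunc x n + trunc t n)) by lra.
  exact: pdivB.
have -> : trunc (qadd x t) n - trunc w n = trunc x n + trunc t n - trunc w n
     + (trunc (qadd x t) n - (trunc x n + trunc t n)) by lra.
exact: pdivD.
Qed.

Lemma eqm_subC n (x t w : Qp p) : eqm n (qsub x t) w <-> eqm n (qsub x w) t.
Proof. by rewrite !eqm_subP addrAC. Qed.

Lemma eqm_subr n (x t t' : Qp p) : eqm n t t' <-> eqm n (qsub x t) (qsub x t').
Proof.
rewrite (eqm_subC n x t) eqm_subP eqmP; have h := trunc_sub x t' n; split=> h'.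
  have -> : trunc x n - trunc (qsub x t') n - trunc t n =
    - (trunc t n - trunc t' n) - (trunc (qsub x t') n - (trunc x n - trunc t' n)) by lra.
  by apply: pdivB => //; apply: pdivN.
have -> : trunc t n - trunc t' n = - (trunc x n - trunc (qsub x t') n - trunc t n)
   - (trunc (qsub x t') n - (trunc x n - trunc t' n)) by lra.
by apply: pdivB => //; apply: pdivN.
Qed.

Lemma eqm_subl n (x x' t : Qp p) : eqm n x x' -> eqm n (qsub x t) (qsub x' t).
Proof.
rewrite eqm_subP eqmP => h; have h' := trunc_sub x' t n.
have -> : trunc x n - trunc t n - trunc (qsub x' t) n =
  (trunc x n - trunc x' n) - (trunc (qsub x' t) n - (trunc x' n - trunc t n)) by lra.
exact: pdivB.
Qed.

Lemma qballE (a y : Qp p) m : qball a m y <-> eqm (- m) a y.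
Proof.
split=> [[z zP <-]|h].
  apply/eqm_sym; rewrite eqm_addP (pZ_trunc_low zP (lexx _)) addr0 subrr.
  exact: pdiv0.
exists (qsub y a); last first.
  apply: Qp_ext => n; rewrite eqm_addP.
  have -> : trunc a n + trunc (qsub y a) n - trunc y n =
    trunc (qsub y a) n - (trunc y n - trunc a n) by lra.
  exact: trunc_sub.
apply/pZ_eqm; rewrite eqm_subP trunc_qp0 subr0.
by apply/eqmP/eqm_sym.
Qed.

(* For [x] in [p^a Z_p], the residue of [p^-a x] modulo [p^l]. *)
Definition qres (a : int) (l : nat) (x : Qp p) : nat :=
  (\sum_(i < l) dig x (a + i%:Z) * p ^ i)%N.

Lemma qresS a l x : qres a l.+1 x = (qres a l x + dig x (a + l%:Z)%R * p ^ l)%N.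
Proof. by rewrite /qres big_ord_recr. Qed.

Lemma qres_lt a l x : (qres a l x < p ^ l)%N.
Proof.
elim: l => [|l IH]; first by rewrite /qres big_ord0.
rewrite qresS expnS; have := dig_lt x (a + l%:Z) p_gt0; nia.
Qed.

Lemma qres_modn a l j x : (j <= l)%N -> (qres a l x %% p ^ j = qres a j x)%N.
Proof.
move=> /subnK <-; elim: (l - j)%N => [|k IH]; first by rewrite modn_small ?qres_lt.
by rewrite addSn qresS expnD mulnA addnC modnMDl.
Qed.

Lemma trunc_qres a l (x : Qp p) : pZ a x ->
  trunc x (a + l%:Z) = (qres a l x)%:R * p%:R ^ a.
Proof.
move=> h; elim: l => [|l IH].
  by rewrite addr0 (pZ_trunc_low h) // /qres big_ord0 mul0r.
rewrite -addn1 PoszD addrA truncS IH addn1 qresS natrD mulrDl; congr (_ + _).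
by rewrite natrM natrX exprnP -mulrA -(expfzDr _ _ P_neq0) addrC.
Qed.

Lemma qres_eqm a l (x y : Qp p) : pZ a x -> pZ a y ->
  (qres a l x = qres a l y) <-> eqm (a + l%:Z) x y.
Proof.
move=> hx hy; split=> [e|/eqm_trunc].
  by rewrite eqmP !trunc_qres // e subrr; apply: pdiv0.
rewrite !trunc_qres // => /(mulIf (lt0r_neq0 (PX_gt0 a))) /eqP.
by rewrite eqr_nat => /eqP.
Qed.

Lemma pZ_add a (x y : Qp p) : pZ a x -> pZ a y -> pZ a (qadd x y).
Proof.
move=> hx hy; apply/pZ_eqm; rewrite eqm_addP trunc_qp0 !(pZ_trunc_low _ (lexx a)) //.
by rewrite addr0 subr0; apply: pdiv0.
Qed.

Lemma pZ_sub a (x y : Qp p) : pZ a x -> pZ a y -> pZ a (qsub x y).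
Proof.
move=> hx hy; apply/pZ_eqm; rewrite eqm_subP trunc_qp0 !(pZ_trunc_low _ (lexx a)) //.
by rewrite !subr0; apply: pdiv0.
Qed.

Lemma qres_sub a l (x t : Qp p) : pZ a x -> pZ a t ->
  (qres a l (qsub x t) + qres a l t = qres a l x %[mod p ^ l])%N.
Proof.
move=> hx ht; have [z] := trunc_sub x t (a + l%:Z).
have hxt := pZ_sub hx ht; rewrite !trunc_qres // -/P (expfzDr _ _ P_neq0) -!mulrBl [P ^ a * _]mulrC mulrA.
move/(mulIf (lt0r_neq0 (PX_gt0 a))).
set A := qres _ _ (qsub _ _); set B := qres _ _ x; set C := qres _ _ t.
(* [z] may be negative; its multiple of [p^l] then goes to the other side so that the congruence
   stays within [nat]. *)
case: z => k e.
  have -> : (A + C = k * p ^ l + B)%N.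
    apply/eqP; rewrite -(eqr_nat rat) !natrD natrM natrX; apply/eqP.
    by rewrite -pmulrn -exprnP -/P in e *; lra.
  by rewrite modnMDl.
have <- : (k.+1 * p ^ l + (A + C) = B)%N.
  apply/eqP; rewrite -(eqr_nat rat) !natrD natrM natrX; apply/eqP.
  by rewrite NegzE rmorphN /= -pmulrn -exprnP -/P in e *; lra.
by rewrite modnMDl.
Qed.

Lemma qres_surj a l c : (c < p ^ l)%N -> exists2 x : Qp p, pZ a x & qres a l x = c.
Proof.
move=> cl; pose x := mkQp p a (fun n => c %/ p ^ `|n - a|)%N.
exists x; first by move=> k ka /=; rewrite ka.
rewrite -[RHS](modn_small cl); elim: l {cl} => [|l IH].
  by rewrite /qres big_ord0 modn1.
rewrite qresS IH modn_expS // addnC /= ltNge lerDl /=; congr (_ * _ + _)%N.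
by rewrite addrC addKr.
Qed.

(** The pairing of [p^a Z_p] with [p^-(a+l) Z_p] modulo 1 factors through [Z/p^l]: changing [x] by
    [p^(a+l) Z_p] or [y] by [p^(-a) Z_p] changes the product by an element of [Z_p]. *)
Lemma fracp_qmul a l (x y : Qp p) : pZ a x -> pZ (- (a + l%:Z)) y ->
  pdiv_by 0 (fracp (qmul y x)
             - (qres a l x * qres (- (a + l%:Z)) l y)%:R / p%:R ^+ l).
Proof.
move=> hx hy; set b := - (a + l%:Z) in hy *.
have E : (qres a l x * qres b l y)%:R / p%:R ^+ l = trunc y (- a) * trunc x (- b) :> rat.
  have -> : - a = b + l%:Z by rewrite /b; lia.
  have -> : - b = a + l%:Z by rewrite /b; lia.
  have e : P ^ b * P ^ a = (P ^+ l)^-1.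
    by rewrite -(expfzDr _ _ P_neq0) exprnN; congr (_ ^ _); rewrite /b; lia.
  by rewrite !trunc_qres // natrM -/P -e; ring.
(* [lb x] and [lb y] are arbitrary lower bounds for the digits, not comparable a priori with [a] and
   [b]. The maxima are still lower bounds, and both cuts [- lb x] and [- a] of [y] are at least
   [- s]. *)
pose s := Num.max a (lb x); pose t := Num.max b (lb y).
have sx m : pdiv_by s (trunc x m).
  by rewrite /s; case: leP => _; apply: pZ_pdiv => //; apply: pZ_lb.
have ty m : pdiv_by t (trunc y m).
  by rewrite /t; case: leP => _; apply: pZ_pdiv => //; apply: pZ_lb.
have D (w : Qp p) (r : int) m m' : - r <= m -> - r <= m' ->
    pdiv_by (- r) (trunc w m - trunc w m').
  wlog mm : m m' / m' <= m => [H|h h'].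
    have [/H//|/ltW mm h h'] := leP m' m.
    by rewrite -opprB; apply/pdivN/H.
  by apply: pdivW h' _; apply: trunc_le.
have S0 := trunc_mul y x 0; rewrite !sub0r in S0.
rewrite E /fracp.
have -> : trunc (qmul y x) 0 - trunc y (- a) * trunc x (- b) =
  (trunc (qmul y x) 0 - trunc y (- lb x) * trunc x (- lb y))
  + ((trunc y (- lb x) - trunc y (- a)) * trunc x (- lb y)
  + (trunc x (- lb y) - trunc x (- b)) * trunc y (- a)) by ring.
apply: pdivD => //; apply: pdivD.
  by rewrite -(addNr s); apply: pdivM => //; apply: D; rewrite lerN2 le_max lexx ?orbT.
by rewrite -(addNr t); apply: pdivM => //; apply: D; rewrite lerN2 le_max lexx ?orbT.
Qed.

End QpArith.

(** * Homogeneity *)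

Lemma card_eq_I1 (D : set nat) d : D d -> (D #= `I_1)%card <-> forall e, D e -> e = d.
Proof.
move=> Dd; split=> [/card_set_bijP[f [ff fi _]] e De|h].
  have f0 x : D x -> f x = 0%N by move=> /ff /=; case: (f x).
  by apply: fi; rewrite ?inE // !f0.
have -> : D = [set d] by apply/seteqP; split=> [e /h ->//|e ->].
exact: card_set1.
Qed.

Lemma card_eq_In (D : set nat) n : D `<=` `I_n ->
  (D #= `I_n)%card <-> forall e, (e < n)%N -> D e.
Proof.
move=> Dn; split=> [|h]; last first.
  by have -> : D = `I_n by apply/seteqP; split.
rewrite card_eq_sym => /card_set_bijP[g [gf gi _]] e en.
have gP (i : 'I_n) : (g i < n)%N by apply/Dn/gf/ltn_ord.
pose g' (i : 'I_n) := Ordinal (gP i).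
have g'i : injective g'.
  move=> i j /(congr1 val) /= e'; apply: val_inj.
  by apply: gi => //; rewrite inE /=; apply: ltn_ord.
have /codomP[i ie] := injF_onto g'i (Ordinal en).
have -> : e = g i by have := congr1 val ie.
by apply/gf/ltn_ord.
Qed.

Section Homogeneity.
Variable p : nat.
Hypothesis p_pr : prime p.
Let p_gt0 : (0 < p)%N. Proof. exact: prime_gt0. Qed.

Implicit Types Om : set (Qp p).

Definition qone_child Om (n : int) : Prop :=
  forall x y, Om x -> Om y -> eqm n x y -> eqm (n + 1) x y.

Definition qall_children Om (n : int) : Prop :=
  forall x d, Om x -> (d < p)%N -> exists2 y, Om y & eqm n x y /\ dig y n = d.

(** The points of a child share their digits up to position [n], and those below [n] are the digits
    of [x]; so a child is labelled by its digit at [n]. *)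
Lemma children_card Om n (B : set (Qp p)) x : Nballs Om n B -> B x -> Om x ->
  (children Om n B #= [set d | exists2 y, Om y & eqm n x y /\ dig y n = d])%card.
Proof.
move=> [[b Bb] _] Bx Ox; set D := [set d | _].
pose F d : set (Qp p) := [set y | eqm n x y /\ dig y n = d].
have xb : eqm n b x by move: Bx; rewrite Bb qballE // opprK.
suff -> : children Om n B = F @` D.
  apply: inj_card_eq => d d'; rewrite inE => -[y Oy [xy dy]] _ e.
  have : F d y by [].
  by rewrite e => -[_ <-].
apply/seteqP; split=> [B' [[[c B'c] [y [B'y Oy]]] sub]|_ [d [y Oy [xy dy]] <-]].
  have cy : eqm (n + 1) c y by move: B'y; rewrite B'c qballE // opprK.
  have xy : eqm n x y.
    apply: eqm_trans (eqm_sym xb) _.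
    by have := sub y B'y; rewrite Bb qballE // opprK.
  exists (dig y n); first by exists y.
  rewrite B'c; apply/seteqP; split=> w; rewrite /= qballE // opprK.
    move=> [xw wy]; apply: eqm_trans cy _; apply: eqmS => //.
    exact: eqm_trans (eqm_sym xy) xw.
  move=> cw; have yw := eqm_trans (eqm_sym cy) cw; split.
    by apply: eqm_trans xy _; apply: eqmW yw; rewrite lerDl.
  by rewrite yw // ltrDl.
split; last first.
  move=> w [xw _]; rewrite Bb qballE // opprK; exact: eqm_trans xb xw.
split; last by exists y.
exists y; apply/seteqP; split=> w; rewrite /= qballE // opprK.
  by move=> [xw wd]; apply: eqmS; rewrite ?wd //; exact: eqm_trans (eqm_sym xy) xw.
move=> yw; split; last by rewrite -(yw n) // ltrDl.
by apply: eqm_trans xy _; apply: eqmW yw; rewrite lerDl.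
Qed.

Lemma p_homogeneousP Om :
  p_homogeneous Om <-> forall n, qone_child Om n \/ qall_children Om n.
Proof.
have Dlt n x : [set d | exists2 y, Om y & eqm n x y /\ dig y n = d] `<=` `I_p.
  by move=> d [y _ [_ <-]] /=; apply: dig_lt.
have Nx n x : Om x -> Nballs Om n (qball x (- n)) /\ qball x (- n) x.
  move=> Ox; have xx : qball x (- n) x by rewrite qballE.
  by split=> //; split; [exists x|exists x].
split=> [hom n|H n].
  case: (hom n) => h; [left|right].
    move=> x y Ox Oy xy; have [Nb Bx] := Nx n x Ox.
    have := h _ Nb; rewrite (card_eql (children_card Nb Bx Ox)).
    move=> /(card_eq_I1 (d := dig x n)) => /(_ ltac:(by exists x)) e.
    by apply: eqmS => //; rewrite (e (dig y n)) //; exists y.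
  move=> x d Ox dp; have [Nb Bx] := Nx n x Ox.
  have := h _ Nb; rewrite (card_eql (children_card Nb Bx Ox)).
  by move=> /card_eq_In => /(_ (Dlt n x))/(_ d dp).
case: (H n) => h; [left|right] => B NB; have [_ [x [Bx Ox]]] := NB;
  rewrite (card_eql (children_card NB Bx Ox)).
  apply/(card_eq_I1 (d := dig x n)); first by exists x.
  by move=> d [y Oy [xy <-]]; rewrite (h x y) // ltrDl.
by apply/card_eq_In => // d dp; apply: h.
Qed.

Definition bounded_by Om (a : int) : Prop := Om `<=` pZ a.
Definition constant_at Om (N : int) : Prop :=
  forall x y, Om x -> eqm N x y -> Om y.

Lemma constant_at_le Om m n : m <= n -> constant_at Om m -> constant_at Om n.
Proof. by move=> mn cO x y Ox xy; apply: cO Ox _; apply: eqmW xy. Qed.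

Lemma compact_bounded Om : qp_compact Om -> exists a, bounded_by Om a.
Proof.
move=> cO; pose U (i : int) : set (Qp p) := pZ i.
have [i x Ux|x _|F [fF sub]] := cO int U.
- exists (- i) => y; rewrite qballE // opprK => xy k ki; rewrite -xy //; exact: Ux.
- by exists (lb x) => //; apply: pZ_lb.
have /finite_seqP[s sE] := fF.
(* The sum of absolute values dominates every index of the finite subcover. *)
exists (- (\sum_(i <- s) `|i|)) => x /sub[i Fi Ui] k kb; apply: Ui.
apply: lt_le_trans kb _; rewrite sE /= in Fi.
rewrite (big_rem i) //= lerNl; apply: le_trans (_ : `|i| <= _).
  by rewrite -normrN ler_norm.
by rewrite lerDl sumr_ge0.
Qed.

Lemma compact_open_constant Om : qp_compact Om -> qp_open Om ->
  exists N, constant_at Om N.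
Proof.
move=> cO oO.
(* [U u] is empty unless the ball lies inside [Om], so every member of the cover is a subset of
   [Om]. *)
pose U (u : Qp p * int) : set (Qp p) := [set y | qball u.1 u.2 `<=` Om /\ qball u.1 u.2 y].
have [u y [s uy]|x Ox|F [fF sub]] := cO _ U.
- exists u.2 => z yz; split=> //; move: uy yz; rewrite !qballE //.
  exact: eqm_trans.
- have [n nP] := oO x Ox; exists (x, n) => //; split=> //=.
  by rewrite qballE.
have /finite_seqP[s sE] := fF.
exists (\sum_(u <- s) `|u.2|) => x y /sub[u Fu [su ux]] xy; apply: su.
apply/qballE => //; move/qballE: ux => /(_ p_pr) ux; apply: (eqm_trans ux); apply: eqmW xy.
rewrite sE /= in Fu; rewrite (big_rem u) //=; apply: le_trans (_ : `|u.2| <= _).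
  by rewrite -normrN ler_norm.
by rewrite lerDl sumr_ge0.
Qed.

Definition cutdig (x : Qp p) (n : int) (d : nat) : Qp p :=
  mkQp p (Num.min (lb x) n) (fun k => if k < n then dig x k else if k == n then d else 0%N).

Lemma cutdigE x n d k : (d < p)%N -> dig (cutdig x n d) k =
  if k < n then dig x k else if k == n then d else 0%N.
Proof.
move=> dp; rewrite /= lt_min; case: (ltP k n) => kn.
  rewrite andbT; case: ltP => kl; first by rewrite lbP.
  by rewrite modn_small // dig_lt.
by rewrite andbF; case: eqP => _; rewrite modn_small.
Qed.

Lemma eqm_cutdig x n d : (d < p)%N -> eqm n x (cutdig x n d).
Proof. by move=> dp k kn; rewrite cutdigE // kn. Qed.

Lemma dig_cutdig x n d : (d < p)%N -> dig (cutdig x n d) n = d.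
Proof. by move=> dp; rewrite cutdigE // ltxx eqxx. Qed.

Lemma constant_all_children Om N n : constant_at Om N -> N <= n -> qall_children Om n.
Proof.
move=> cO Nn x d Ox dp; exists (cutdig x n d).
  by apply: cO Ox _; apply: eqmW Nn _; apply: eqm_cutdig.
by split; [apply: eqm_cutdig|apply: dig_cutdig].
Qed.

Lemma bounded_one_child Om a n : bounded_by Om a -> n < a -> qone_child Om n.
Proof.
move=> bO na x y /bO hx /bO hy _ k; rewrite ltzD1 => kn.
by rewrite hx ?hy // (le_lt_trans kn).
Qed.

(** * A tiling complement of a homogeneous set *)

Section Tile.
Variables (Om : set (Qp p)) (a N : int).
Hypothesis Om_bnd : bounded_by Om a.
Hypothesis Om_cst : constant_at Om N.
Hypothesis hom : forall n, qone_child Om n \/ qall_children Om n.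

Definition tile_set : set (Qp p) :=
  [set t | forall n, dig t n <> 0%N -> ~ qall_children Om n].

(** [t] is built digit by digit so that [x - t] agrees below [n] with a point [w] of [Om]. At a full
    level [w] is replaced and [t] kept; at any other level the next digit of [t] is read off
    [x - w]. Agreement up to [N] puts [x - t] in [Om]. *)
Lemma tile_set_cover x : Om !=set0 -> exists2 t, tile_set t & Om (qsub x t).
Proof.
move=> [w0 Ow0].
suff [t Tt [w Ow e]] : exists2 t, tile_set t & exists2 w, Om w & eqm N (qsub x t) w.
  by exists t => //; apply: Om_cst Ow _; apply: eqm_sym.
move: N; apply: (@int_up_ind (Num.min a (lb x))) => [n|n _ [t Tt [w Ow e]]].
  rewrite le_min => /andP[na nl].
  exists (qp0 p); first by [].
  exists w0 => //; rewrite eqm_subP // trunc_qp0 (pZ_trunc_low p_pr (Om_bnd Ow0)) //.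
  by rewrite trunc_low // !subr0; apply: pdiv0.
have [B|nB] := pselect (qall_children Om n).
  have [y Oy [wy dy]] := B w (dig (qsub x t) n) Ow (dig_lt _ _ p_gt0).
  exists t => //; exists y => //; apply: eqmS; last by rewrite dy.
  exact: eqm_trans e wy.
pose d := dig (qsub x w) n.
have dp : (d < p)%N by apply: dig_lt.
exists (cutdig t n d).
  move=> k; rewrite cutdigE //; case: ifP => _; first exact: Tt.
  by case: eqP => [->|].
exists w => //; apply/eqm_subC => //; apply: eqmS; last by rewrite dig_cutdig.
have h : eqm n (qsub x w) t by apply/eqm_subC.
by apply: (eqm_trans h); apply: eqm_cutdig.
Qed.

(** If [t] and [t'] agree below [n], so do [x - t] and [x - t']. At a one-child level these, and
    hence [t] and [t'], agree at [n] too; at a full level both digits are 0. *)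
Lemma tile_set_uniq x t t' : tile_set t -> tile_set t' ->
  Om (qsub x t) -> Om (qsub x t') -> t = t'.
Proof.
move=> Tt Tt' O1 O2; apply: Qp_ext.
apply: (@int_up_ind (Num.min (lb t) (lb t'))) => [n|n _ e].
  rewrite le_min => /andP[h1 h2] k kn.
  by rewrite !lbP // (lt_le_trans kn).
have [A|B] := hom n.
  exact: (proj2 (eqm_subr p_pr (n + 1) x t t')
            (A _ _ O1 O2 (proj1 (eqm_subr p_pr n x t t') e))).
apply: eqmS => //.
have z s : tile_set s -> dig s n = 0%N.
  by move=> Ts; apply: contrapT => /Ts; apply.
by rewrite !z.
Qed.

End Tile.

(** * Passing from [Om] to its residues modulo [p^l] *)

Definition window Om (a : int) (l : nat) : pred nat :=
  fun c => `[< exists2 x, Om x & qres a l x = c >].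

Lemma window_lt Om a l c : window Om a l c -> (c < p ^ l)%N.
Proof. by move=> /asboolP[x _ <-]; apply: qres_lt. Qed.

(** Modulo [p^(j+1)], adding [d p^j] changes only the digit at [a + j], and the carry is lost. *)
Lemma qres_next a l j (x y : Qp p) d : (j < l)%N ->
  (qres a l y = qres a l x + d * p ^ j %[mod p ^ j.+1])%N <->
  qres a j y = qres a j x /\ dig y (a + j%:Z) = ((dig x (a + j%:Z) + d) %% p)%N.
Proof.
move=> jl; rewrite -(modnDml (qres a l x)) !qres_modn //.
have pj : (0 < p ^ j)%N by rewrite expn_gt0 p_gt0.
have E (u : Qp p) e : ((qres a j u + e * p ^ j) %/ p ^ j = e)%N.
  by rewrite addnC divnMDl // divn_small ?addn0 // qres_lt.
have -> : (qres a j.+1 x + d * p ^ j = qres a j x + (dig x (a + j%:Z) + d) * p ^ j)%N.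
  by rewrite qresS mulnDl addnA.
rewrite -[X in X = _](modn_small (qres_lt p_pr a j.+1 y)).
transitivity (is_true (qres a j.+1 y == qres a j x + (dig x (a + j%:Z) + d) * p ^ j %[mod p ^ j.+1])%N).
  by split=> /eqP.
rewrite eqmod_expS // qresS !E [(_ + dig y _ * _)%N]addnC [(qres a j x + _)%N]addnC.
rewrite !modnMDl (modn_small (qres_lt p_pr a j y)) (modn_small (qres_lt p_pr a j x)).
rewrite (modn_small (dig_lt y _ p_gt0)).
by split=> [/andP[/eqP -> /eqP ->]|[-> ->]] //; rewrite !eqxx.
Qed.

Lemma window_one_child Om a l j : bounded_by Om a -> (j < l)%N ->
  one_child p (window Om a l) j <-> qone_child Om (a + j%:Z).
Proof.
move=> bO jl; have S : a + j%:Z + 1 = a + j.+1%:Z by lia.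
have L (x y : Qp p) i : (i <= l)%N -> Om x -> Om y ->
    (qres a l x = qres a l y %[mod p ^ i])%N <-> eqm (a + i%:Z) x y.
  by move=> il Ox Oy; rewrite !qres_modn //; apply: qres_eqm => //; apply: bO.
split=> [h x y Ox Oy xy|h c c' /asboolP[x Ox <-] /asboolP[y Oy <-]].
  rewrite S; apply/L => //; apply: h; [by apply/asboolP; exists x|by apply/asboolP; exists y|].
  by apply/L => //; apply: ltnW.
move=> /L e; apply/L => //; rewrite -S; apply: h => //; apply: e => //.
exact: ltnW.
Qed.

Lemma window_all_children Om a l j : bounded_by Om a -> (j < l)%N ->
  all_children p (window Om a l) j <-> qall_children Om (a + j%:Z).
Proof.
move=> bO jl.
have L (x y : Qp p) : Om x -> Om y -> (qres a j y = qres a j x) <-> eqm (a + j%:Z) x y.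
  by move=> Ox Oy; split=> [e|e]; [apply/qres_eqm|apply/esym/qres_eqm]; rewrite ?e //; apply: bO.
split=> [h x e Ox ep|h c d /asboolP[x Ox <-]].
  have dx := dig_lt x (a + j%:Z) p_gt0.
  (* This shift turns the digit of [x] into [e] modulo [p] while staying in [nat]. *)
  have [|_ /asboolP[y Oy <-]] := h (qres a l x) (e + (p - dig x (a + j%:Z)))%N.
    by apply/asboolP; exists x.
  move/(qres_next a x y _ jl) => [/L h1 h2]; exists y => //; split; first exact: h1.
  by rewrite h2 addnCA subnKC ?modnDr ?modn_small // ltnW.
have [y Oy [xy yd]] := h x ((dig x (a + j%:Z) + d) %% p)%N Ox (ltn_pmod _ p_gt0).
exists (qres a l y); first by apply/asboolP; exists y.
by apply/qres_next => //; split=> //; apply/L.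
Qed.

(** Only the levels in [[a, a + l)] carry information: below [a] every point of [Om] has digit 0,
    and from [a + l] on all digits are free. *)
Lemma window_homogeneous Om a l : bounded_by Om a -> constant_at Om (a + l%:Z) ->
  (forall n, qone_child Om n \/ qall_children Om n) <->
  (forall j, (j < l)%N -> one_child p (window Om a l) j \/ all_children p (window Om a l) j).
Proof.
move=> bO cO; split=> [H j jl|H n].
  by rewrite window_one_child // window_all_children.
have [na|an] := ltP n a; first by left; apply: bounded_one_child na.
have [Nn|nN] := leP (a + l%:Z) n; first by right; apply: constant_all_children Nn.
have nE : n = a + `|n - a|%N%:Z by lia.
have jl : (`|n - a| < l)%N by lia.
by have := H _ jl; rewrite window_one_child // window_all_children // -nE.
Qed.

End Homogeneity.

(** * Characters of [Q_p] as roots of unity *)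

Section Characters.
Variable R : realType.

Definition expi (t : R) : R[i] := (cos t +i* sin t)%C.

Lemma expi0 : expi 0 = 1.
Proof. by rewrite /expi cos0 sin0. Qed.

Lemma expiD s t : expi (s + t) = expi s * expi t.
Proof. by rewrite /expi cosD sinD; simpc; rewrite [cos s * sin t + _]addrC. Qed.

Lemma expi_neq0 t : expi t != 0.
Proof.
apply/eqP => h; have := expiD t (- t); rewrite subrr expi0 h mul0r.
by move/eqP; rewrite oner_eq0.
Qed.

Lemma expiN t : expi (- t) = (expi t)^-1.
Proof.
by apply: (mulfI (expi_neq0 t)); rewrite -expiD subrr expi0 divff ?expi_neq0.
Qed.

Lemma expiB s t : expi (s - t) = expi s / expi t.
Proof. by rewrite expiD expiN. Qed.

Lemma expiMn t n : expi (t *+ n) = expi t ^+ n.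
Proof.
by elim: n => [|n IH]; rewrite ?mulr0n ?expi0 ?expr0 // mulrSr expiD IH exprSr.
Qed.

Lemma expi_2pi : expi (2 * pi) = 1.
Proof.
have -> : 2 * pi = pi + pi :> R by ring.
rewrite expiD /expi cospi sinpi; simpc; by [].
Qed.

Lemma expi_2piz (z : int) : expi (2 * pi * z%:~R) = 1.
Proof.
case: z => n; first by rewrite -pmulrn mulr_natr expiMn expi_2pi expr1n.
by rewrite NegzE rmorphN mulrN expiN /= -pmulrn mulr_natr expiMn expi_2pi expr1n invr1.
Qed.

(** [cos t = 1 - 2 sin(t/2)^2], and [sin(t/2)] is positive as [t/2] lies strictly between 0 and
    [pi]. *)
Lemma expi_neq1 t : 0 < t -> t < 2 * pi -> expi t != 1.
Proof.
move=> t0 t1; apply/eqP => -[c1 _].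
have s0 : 0 < sin (t / 2) by apply: sin_gt0_pi; rewrite divr_gt0 //= ltr_pdivrMr // mulrC.
have := cosD (t / 2) (t / 2); rewrite -splitr c1 -!expr2 => h.
have := cos2Dsin2 (t / 2) => h2; nra.
Qed.

Definition zeta (m : nat) : R[i] := expi (2 * pi / m%:R).

Lemma zeta_prim m : (0 < m)%N -> m.-primitive_root (zeta m).
Proof.
move=> m0; have tp : 0 < 2 * pi :> R by rewrite mulr_gt0 ?pi_gt0.
have mR : (m%:R : R) != 0 by rewrite pnatr_eq0 -lt0n.
have z1 : zeta m ^+ m = 1 by rewrite -expiMn -[_ *+ m]mulr_natr divfK // expi_2pi.
have [k kP km] := prim_order_exists m0 z1.
have k0 := prim_order_gt0 kP.
have := dvdn_leq m0 km; rewrite leq_eqVlt => /orP[/eqP e|klt]; first by rewrite -{1}e.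
have h0 : 0 < 2 * pi / m%:R *+ k :> R.
  by rewrite -[_ *+ k]mulr_natr mulr_gt0 ?ltr0n // divr_gt0 ?ltr0n.
have h1 : 2 * pi / m%:R *+ k < 2 * pi :> R.
  by rewrite -[_ *+ k]mulr_natr mulrAC ltr_pdivrMr ?ltr0n // ltr_pM2l // ltr_nat.
by have := prim_expr_order kP; rewrite -expiMn => /eqP; rewrite (negbTE (expi_neq1 h0 h1)).
Qed.

(** [fracp_qmul] gives the fractional part up to an integer, which [expi] does not see. *)
Lemma expi_chi (p : nat) (a : int) (l : nat) (x y : Qp p) : prime p ->
  pZ a x -> pZ (- (a + l%:Z)) y ->
  expi (chi_arg R y x) = zeta (p ^ l) ^+ (qres a l x * qres (- (a + l%:Z)) l y).
Proof.
move=> p_pr hx hy; have [z] := fracp_qmul p_pr hx hy.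
rewrite expr0z mulr1 => /eqP; rewrite subr_eq => /eqP E.
rewrite /chi_arg E rmorphD /= ratr_int mulrDr expiD expi_2piz mul1r.
rewrite rmorphM /= fmorphV rmorphXn /= !ratr_nat /zeta -expiMn natrX; congr expi.
by rewrite -[in RHS](mulr_natr (2 * pi / _)); ring.
Qed.

End Characters.

(** * Integration of locally constant functions *)

Section HaarIntegral.
Variables (p : nat) (R : realType) (mu : {measure set (QpM p) -> \bar R}).
Hypothesis p_pr : prime p.
Hypothesis haar : is_haar mu.
Let p_gt0 : (0 < p)%N. Proof. exact: prime_gt0. Qed.

Implicit Types E : set (Qp p).

Lemma measurable_qball (x : Qp p) m : measurable (qball x m : set (QpM p)).
Proof. by apply: sub_sigma_algebra; exists x, m. Qed.

Lemma qball0 n : qball (qp0 p) (- n) = pZ n.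
Proof.
apply/seteqP; split=> y.
  by move/qballE => /(_ p_pr); rewrite opprK => /eqm_sym.
by move=> h; apply/qballE => //; rewrite opprK; apply: eqm_sym.
Qed.

Lemma measurable_pZ n : measurable (pZ n : set (QpM p)).
Proof. by rewrite -qball0; apply: measurable_qball. Qed.

Lemma mu_qball (x : Qp p) n : mu (qball x (- n)) = mu (pZ n).
Proof. by rewrite /qball opprK; apply: haar.1; apply: measurable_pZ. Qed.

Definition cell (a : int) (l c : nat) : set (QpM p) :=
  [set y | pZ a y /\ qres a l y = c].

Lemma cellE a l (x : Qp p) : pZ a x -> cell a l (qres a l x) = qball x (- (a + l%:Z)).
Proof.
move=> hx; apply/seteqP; split=> y; rewrite qballE // opprK.
  by move=> [hy e]; apply/qres_eqm.
move=> xy; have hy : pZ a y by move=> k ka; rewrite -xy ?hx //; lia.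
by split=> //; apply/esym/qres_eqm.
Qed.

Lemma cell_ball a l c : (c < p ^ l)%N ->
  exists2 x : Qp p, pZ a x & cell a l c = qball x (- (a + l%:Z)).
Proof. by move=> /(qres_surj p_pr a)[x hx <-]; exists x => //; apply: cellE. Qed.

Lemma measurable_cell a l (c : 'I_(p ^ l)) : measurable (cell a l c).
Proof. by have [x _ ->] := cell_ball a (ltn_ord c); apply: measurable_qball. Qed.

Lemma mu_cell a l (c : 'I_(p ^ l)) : mu (cell a l c) = mu (pZ (a + l%:Z)).
Proof. by have [x _ ->] := cell_ball a (ltn_ord c); apply: mu_qball. Qed.

Lemma trivIset_cell a l (D : set 'I_(p ^ l)) : trivIset D (fun c => cell a l c).
Proof.
move=> c c' _ _ [y [[_ e] [_ e']]]; apply: val_inj.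
by rewrite /= -e -e'.
Qed.

Definition cells (E : set (Qp p)) a l : seq 'I_(p ^ l) :=
  [seq c : 'I_(p ^ l) <- index_enum 'I_(p ^ l) | window E a l c].

Lemma cells_uniq E a l : uniq (cells E a l).
Proof. by rewrite filter_uniq // index_enum_uniq. Qed.

Lemma window_cells E a l : bounded_by E a -> constant_at E (a + l%:Z) ->
  E = \big[setU/set0]_(c <- cells E a l) cell a l c.
Proof.
move=> bE cE; rewrite -bigcup_seq; apply/seteqP; split=> [x Ex|x [c]].
  exists (Ordinal (qres_lt p_pr a l x)); last by split=> //; apply: bE.
  by rewrite /= mem_filter mem_index_enum andbT; apply/asboolP; exists x.
rewrite /= mem_filter => /andP[/asboolP[y Ey e] _] [hx e'].
by apply: (cE _ _ Ey); apply/(qres_eqm p_pr l (bE _ Ey) hx); rewrite e e'.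
Qed.

Lemma measurable_window E a l : bounded_by E a -> constant_at E (a + l%:Z) ->
  measurable (E : set (QpM p)).
Proof.
move=> bE cE; rewrite (window_cells bE cE); apply: bigsetU_measurable => c _.
exact: measurable_cell.
Qed.

Lemma mu_cells E a l : mu (\big[setU/set0]_(c <- cells E a l) cell a l c) =
  (\sum_(c < p ^ l | window E a l c) mu (cell a l c))%E.
Proof.
rewrite /cells big_filter measure_bigsetU_ord_cond // => [c _|].
  exact: measurable_cell.
exact: trivIset_cell.
Qed.

(** [Z_p] is a finite union of translates of [p^n Z_p]; were these null, [Z_p] would be null,
    against the normalization. *)
Lemma mu_pZ_gt0 n : 0 <= n -> (0 < mu (pZ n))%E.
Proof.
move=> n0; have nE : n = 0 + `|n|%N%:Z by lia.
rewrite lt0e measure_ge0 andbT; apply/eqP => h0.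
have b0 : bounded_by (pZ 0 : set (Qp p)) 0 by [].
have c0 : constant_at (pZ 0 : set (Qp p)) (0 + `|n|%N%:Z).
  by move=> x y hx xy k k0; rewrite -xy ?hx //; lia.
have := haar.2; rewrite (window_cells b0 c0).
rewrite mu_cells.
rewrite big1 => [/eqP|c _]; first by rewrite eq_sym onee_eq0.
by rewrite mu_cell -nE.
Qed.

Lemma mu_pZ_fin n : 0 <= n -> (mu (pZ n) < +oo)%E.
Proof.
move=> n0; apply: le_lt_trans (ltry 1); rewrite -haar.2.
apply: le_measure; rewrite ?inE; try exact: measurable_pZ.
by move=> x hx k k0; apply: hx; apply: lt_le_trans k0 n0.
Qed.

Definition mass (n : int) : R := fine (mu (pZ n)).

Lemma massE n : 0 <= n -> mu (pZ n) = (mass n)%:E.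
Proof.
move=> n0; rewrite /mass fineK // fin_numElt mu_pZ_fin // andbT.
exact: lt_trans (mu_pZ_gt0 n0).
Qed.

Lemma mass_gt0 n : 0 <= n -> 0 < mass n.
Proof. by move=> n0; have := mu_pZ_gt0 n0; rewrite massE. Qed.

Lemma mu_window_fin E a l : 0 <= a + l%:Z ->
  bounded_by E a -> constant_at E (a + l%:Z) -> (mu E < +oo)%E.
Proof.
move=> al bE cE; rewrite (window_cells bE cE).
rewrite mu_cells.
by rewrite lte_sum_pinfty // => c _; rewrite mu_cell mu_pZ_fin.
Qed.

Lemma measurable_fun_window E a l (g : nat -> R) (f : QpM p -> R) :
  bounded_by E a -> constant_at E (a + l%:Z) ->
  (forall x, E x -> f x = g (qres a l x)) ->
  measurable_fun (E : set (QpM p)) f.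
Proof.
move=> bE cE fE.
apply: (eq_measurable_fun (fun x => \sum_(c < p ^ l) g c * \1_(cell a l c) x)).
  move=> x; rewrite inE => Ex; rewrite fE //.
  rewrite (bigD1 (Ordinal (qres_lt p_pr a l x))) //= indicE mem_set; last first.
    by split=> //; apply: bE.
  rewrite mulr1 big1 ?addr0 // => c nc; rewrite indicE memNset ?mulr0 //.
  by move=> [_ e]; move/eqP: nc; apply; apply: val_inj.
apply: measurable_sum => c; apply: measurable_funM => //.
by apply: measurable_indic; apply: measurable_cell.
Qed.

Lemma integral_cells E a l (f : QpM p -> R) :
  bounded_by E a -> constant_at E (a + l%:Z) ->
  measurable_fun (E : set (QpM p)) f ->
  (\int[mu]_(x in E) (f x)%:E =
   \sum_(c < p ^ l | window E a l c) \int[mu]_(x in cell a l c) (f x)%:E)%E.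
Proof.
move=> bE cE mf; rewrite {1}(window_cells bE cE).
rewrite integral_bigsetU_EFin => [|c|||]; last first.
- by rewrite -window_cells //; apply/measurable_EFinP.
- exact: trivIset_cell.
- exact: cells_uniq.
- exact: measurable_cell.
by rewrite /cells big_filter.
Qed.

(** [f] is constant on every cell of [E], and all cells have the same mass by translation
    invariance. *)
Lemma integral_window E a l (g : nat -> R) (f : QpM p -> R) : 0 <= a + l%:Z ->
  bounded_by E a -> constant_at E (a + l%:Z) ->
  (forall x, E x -> f x = g (qres a l x)) ->
  (\int[mu]_(x in E) (f x)%:E =
   (mass (a + l%:Z) * \sum_(c < p ^ l | window E a l c) g c)%:E)%E.
Proof.
move=> al bE cE fE; rewrite (integral_cells bE cE) //; last exact: measurable_fun_window fE.
rewrite mulr_sumr -sumEFin; apply: eq_bigr => c /asboolP[y Ey e].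
rewrite (eq_integral (cst (g c)%:E)) => [|x].
  by rewrite integral_cst ?mu_cell ?massE // ?EFinM 1?muleC //; apply: measurable_cell.
rewrite inE => -[hx e']; rewrite fE ?e' //.
by apply: (cE _ _ Ey); apply/(qres_eqm p_pr l (bE _ Ey) hx); rewrite e e'.
Qed.

End HaarIntegral.

(** * Tiling *)

Section IndicatorSum.
Variables (R : realType) (I : choiceType) (T P : set I).
Let f (i : I) : \bar R := (\1_P i)%:E.
Let f_ge0 i : (0 <= f i)%E. Proof. by rewrite lee_fin indicE. Qed.
Let f1 i : P i -> f i = 1%E. Proof. by move=> h; rewrite /f indicE mem_set. Qed.
Let f0 i : ~ P i -> f i = 0%E. Proof. by move=> h; rewrite /f indicE memNset. Qed.

Lemma esum_indic_split t : T t ->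
  (\esum_(i in T) f i = f t + \esum_(i in T `&` ~` [set t]) f i)%E.
Proof.
move=> Tt; rewrite (esumID [set t]) // (_ : T `&` [set t] = [set t]).
  by rewrite esum_fset // fsbig_set1.
by apply/seteqP; split=> [i []|i ->].
Qed.

(** The sum counts the points of [T] lying in [P]: without any it is 0, and two distinct ones make
    it at least 2. *)
Lemma esum_indic_eq1 : (\esum_(i in T) f i = 1)%E <->
  (exists2 t, T t & P t) /\ (forall t t', T t -> T t' -> P t -> P t' -> t = t').
Proof.
split=> [h|[[t Tt Pt] u]]; last first.
  rewrite (esum_indic_split Tt) f1 // esum1 ?adde0 // => i [Ti ni].
  by apply: f0 => Pi; apply: ni; apply: u.
split.
  apply: contrapT => N; move: h; rewrite esum1 => [/eqP|i Ti]; first by rewrite eq_sym onee_eq0.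
  by apply: f0 => Pi; apply: N; exists i.
move=> t t' Tt Tt' Pt Pt'; apply: contrapT => ne.
move: h; rewrite (esum_indic_split Tt) f1 // => h.
have : (1 <= \esum_(i in T `&` ~` [set t]) f i)%E.
  apply: esum_ge; exists [set t'].
    split; first exact: finite_set1.
    by move=> _ ->; split=> //; apply: nesym.
  by rewrite fsbig_set1 f1.
by move/(leeD2l 1%E); rewrite h -EFinD lee_fin; lra.
Qed.

End IndicatorSum.

(** * Tilings of [Q_p] by a bounded locally constant set *)

Section TilingTheorem.
Variables (p : nat) (R : realType) (mu : {measure set (QpM p) -> \bar R}).
Hypothesis p_pr : prime p.
Hypothesis haar : is_haar mu.
Variables (Om : set (Qp p)) (a : int) (l : nat).
Hypothesis al_ge0 : 0 <= a + l%:Z.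
Hypothesis Om_bnd : bounded_by Om a.
Hypothesis Om_cst : constant_at Om (a + l%:Z).

(** A ball has positive measure, so it is not contained in a null set. This upgrades locally
    constant statements from almost everywhere to everywhere. *)
Lemma negligible_constant (A : set (QpM p)) x n : 0 <= n ->
  {ae mu, forall y, A y} -> (forall y, eqm n x y -> ~ A y) -> False.
Proof.
move=> n0 [B [mB B0 sub]] h.
have : (mu (qball x (- n)) <= mu B)%E.
  apply: le_measure; rewrite ?inE //; first exact: measurable_qball.
  by move=> y /qballE => /(_ p_pr); rewrite opprK => /h; apply: sub.
by rewrite (mu_qball p_pr haar) B0 leNgt (mu_pZ_gt0 p_pr haar n0).
Qed.

Lemma homogeneous_tiles : Om !=set0 ->
  (forall n, qone_child Om n \/ qall_children Om n) -> tiles mu (Om : set (QpM p)).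
Proof.
move=> ne hom; exists (tile_set Om); apply: aeW => x.
apply: (proj2 (esum_indic_eq1 R (tile_set Om) [set t | Om (qsub x t)])); split.
  exact: tile_set_cover Om_bnd Om_cst x ne.
move=> t t' Tt Tt'; exact: tile_set_uniq.
Qed.

(** Whether [x - t] lies in [Om] depends only on [x] modulo [p^(a+l)], uniformly in [t]; so a
    failure at one point would be a failure on a whole ball. *)
Lemma tiles_exact (T : set (Qp p)) :
  {ae mu, forall x : QpM p, (\esum_(t in T) (\1_(Om : set (QpM p)) (qsub x t) : R)%:E = 1)%E} ->
  forall x, (exists2 t, T t & Om (qsub x t)) /\
    (forall t t', T t -> T t' -> Om (qsub x t) -> Om (qsub x t') -> t = t').
Proof.
move=> ae x; apply: contrapT => N.
apply: (@negligible_constant _ x (a + l%:Z) al_ge0 ae) => y xy e; apply: N.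
apply/(esum_indic_eq1 R T [set t | Om (qsub x t)]); rewrite -[RHS]e.
apply: eq_esum => t _; congr (_%:E); rewrite !indicE; congr (_%:R).
have E : Om (qsub x t) = Om (qsub y t).
  apply/propext; split=> h; apply: (Om_cst h); apply: eqm_subl => //.
  exact: eqm_sym.
by congr nat_of_bool; apply/idP/idP; rewrite !inE /= E.
Qed.

Lemma tiles_homogeneous : tiles mu (Om : set (QpM p)) ->
  forall n, qone_child Om n \/ qall_children Om n.
Proof.
move=> [T /tiles_exact ex]; apply/(window_homogeneous p_pr Om_bnd Om_cst).
(* Points of [p^a Z_p] are covered only by translations in [p^a Z_p]; the residues of these, with
   those of [Om], tile [Z/p^l]. *)
pose T' : set (Qp p) := [set t | T t /\ pZ a t].
have pZt x t : pZ a x -> Om (qsub x t) -> pZ a t.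
  move=> hx /Om_bnd h; have : eqm a (qsub x t) (qp0 p) by [].
  move/(eqm_subP p_pr); rewrite trunc_qp0 (pZ_trunc_low p_pr hx (lexx _)) => h'.
  have : eqm a t (qp0 p); last by [].
  apply/eqmP => //; rewrite trunc_qp0; have := pdivN h'.
  by rewrite subr0 sub0r opprK subr0.
apply: (@homogeneous_of_tiling p l p_pr _ (window T' a l)).
- by move=> c; apply: window_lt.
- by move=> c; apply: window_lt.
- move=> x /(qres_surj p_pr a)[X hX Xx].
  have [[t Tt Ot] _] := ex X; have ht := pZt _ _ hX Ot.
  exists (qres a l (qsub X t)), (qres a l t); split.
  + by apply/asboolP; exists (qsub X t).
  + by apply/asboolP; exists t.
  + by rewrite qres_sub // Xx modn_small // -Xx qres_lt.
move=> c t c' t' /asboolP[w Ow <-] /asboolP[s [Ts hs] <-] /asboolP[w' Ow' <-] /asboolP[s' [Ts' hs'] <-] e.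
(* [x] lies in the translate of [Om] by [s] and, since the residues of [w + s] and [w' + s'] agree,
   also in the one by [s']; uniqueness yields [s = s']. *)
pose x := qadd w s.
have hw := Om_bnd Ow; have hw' := Om_bnd Ow'.
have hx : pZ a x by apply: pZ_add.
have xw : eqm (a + l%:Z) (qsub x s) w.
  apply/eqm_subP => //; have h := trunc_add p_pr w s (a + l%:Z).
  have -> : trunc x (a + l%:Z) - trunc s (a + l%:Z) - trunc w (a + l%:Z) =
    trunc x (a + l%:Z) - (trunc w (a + l%:Z) + trunc s (a + l%:Z)) by lra.
  exact: h.
have Os : Om (qsub x s) by apply: Om_cst Ow _; apply: eqm_sym.
have xw' : qres a l (qsub x s') = qres a l w'.
  have h1 := qres_sub p_pr l hx hs; have h2 := qres_sub p_pr l hx hs'.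
  have h3 : qres a l (qsub x s) = qres a l w by apply/qres_eqm => //; apply: pZ_sub.
  rewrite h3 e in h1; move: h2; rewrite -h1 => /eqP; rewrite eqn_modDr.
  by rewrite !modn_small ?qres_lt // => /eqP.
have Os' : Om (qsub x s').
  apply: (Om_cst Ow'); apply/(qres_eqm p_pr l hw'); last by [].
  exact: pZ_sub.
have ss : s = s' by have [_ u] := ex x; apply: u.
split; last by rewrite ss.
move: e; rewrite ss => /eqP; rewrite eqn_modDr.
by rewrite !modn_small ?qres_lt // => /eqP.
Qed.

End TilingTheorem.

(** * Spectra *)

(** A homogeneous linear system with more unknowns than equations has a nonzero solution, here a
    nonzero row of the left kernel of the matrix of [G]. *)
Lemma left_kernel_fun (F : fieldType) (n : nat) (C Y : pred nat) (G : nat -> nat -> F) :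
  (\sum_(y < n | Y y) 1 < \sum_(c < n | C c) 1)%N ->
  exists f : nat -> F, (exists2 c, (c < n)%N && C c & f c != 0) /\
    forall y, (y < n)%N -> Y y -> \sum_(c < n | C c) f c * G c y = 0.
Proof.
pose C' := [pred c : 'I_n | C c]; pose Y' := [pred y : 'I_n | Y y].
have -> : (\sum_(c < n | C c) 1 = #|C'|)%N by rewrite -sum1_card; apply: eq_bigl.
have -> : (\sum_(c < n | Y c) 1 = #|Y'|)%N by rewrite -sum1_card; apply: eq_bigl.
move=> lt; pose ci (i : 'I_#|C'|) : 'I_n := enum_val i.
pose yj (j : 'I_#|Y'|) : 'I_n := enum_val j.
pose A : 'M[F]_(#|C'|, #|Y'|) := \matrix_(i, j) G (ci i) (yj j).
have kn0 : kermx A != 0.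
  rewrite kermx_eq0 /row_free neq_ltn; apply/orP; left.
  exact: leq_ltn_trans (rank_leq_col A) lt.
have [i vi0] : exists i, row i (kermx A) != 0.
  apply/existsP; apply: contraNT kn0; rewrite negb_exists => /forallP h.
  by apply/eqP/row_matrixP => i; rewrite row0; apply/eqP; have := h i; rewrite negbK.
have : row i (kermx A) *m A = 0 by rewrite -row_mul mulmx_ker row0.
move: (row i (kermx A)) vi0 => v vi0 vA.
have [j vj] : exists j, v 0 j != 0.
  apply/existsP; apply: contraNT vi0; rewrite negb_exists => /forallP h.
  by apply/eqP/rowP => j; rewrite [RHS]mxE; apply/eqP; have := h j; rewrite negbK.
pose c0 := enum_val j; have c0C : c0 \in C' := enum_valP j.
(* Outside [C] the values of [f] are defaults; the sums range over [C] only. *)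
pose f c := if insub c is Some c' then v 0 (enum_rank_in c0C c') else 0.
have fE (k : 'I_#|C'|) : f (enum_val k : 'I_n) = v 0 k.
  by rewrite /f valK enum_valK_in.
exists f; split.
  by exists c0; [rewrite ltn_ord; exact: c0C|rewrite fE].
move=> y yn Yy; have yY : Ordinal yn \in Y' by [].
have := congr1 (fun M : 'rV_#|Y'| => M 0 (enum_rank_in yY (Ordinal yn))) vA.
rewrite [LHS]mxE [RHS]mxE => vA0; rewrite -[RHS]vA0.
transitivity (\sum_(c in C') f c * G c y); first exact: eq_bigl.
rewrite big_enum_val.
by apply: eq_bigr => k _; rewrite fE mxE /yj enum_rankK_in.
Qed.

(** * Integrals of characters, and homogeneity from a spectrum *)

Section SpectralBasics.
Variables (p : nat) (R : realType) (mu : {measure set (QpM p) -> \bar R}).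
Hypothesis p_pr : prime p.
Hypothesis haar : is_haar mu.
Variables (Om : set (Qp p)) (a : int) (l : nat).
Hypothesis al_ge0 : 0 <= a + l%:Z.
Hypothesis Om_bnd : bounded_by Om a.
Hypothesis Om_cst : constant_at Om (a + l%:Z).

Let p_gt0 : (0 < p)%N. Proof. exact: prime_gt0. Qed.
Let pX_gt0 k : (0 < p ^ k)%N. Proof. by rewrite expn_gt0 p_gt0. Qed.

Let constant_at_ge k : (l <= k)%N -> constant_at Om (a + k%:Z).
Proof. by move=> lk; apply: constant_at_le Om_cst; rewrite lerD2l lez_nat. Qed.

Let level_ge0 k : (l <= k)%N -> 0 <= a + k%:Z.
Proof. by move=> lk; apply: le_trans al_ge0 _; rewrite lerD2l lez_nat. Qed.

Lemma zeta_mod k m : zeta R (p ^ k) ^+ (m %% p ^ k) = zeta R (p ^ k) ^+ m.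
Proof. by rewrite expr_mod // (prim_expr_order (zeta_prim R (pX_gt0 k))). Qed.

(** The level [k] is left free above [l] because a frequency may have digits below [-(a + l)]. On
    [Om] the quotient of the two characters is a power of a root of unity, with the residue modulo
    [p^k] as exponent. *)
Lemma chi_sub_integral k (y y' : Qp p) : (l <= k)%N ->
  pZ (- (a + k%:Z)) y -> pZ (- (a + k%:Z)) y' ->
  let S := \sum_(c < p ^ k | window Om a k c)
     (zeta R (p ^ k) ^+ qres (- (a + k%:Z)) k y
      / zeta R (p ^ k) ^+ qres (- (a + k%:Z)) k y') ^+ c in
  (\int[mu]_(x in Om) (cos (chi_arg R y x - chi_arg R y' x))%:E
     = (mass mu (a + k%:Z) * complex.Re S)%:E)%E /\
  (\int[mu]_(x in Om) (sin (chi_arg R y x - chi_arg R y' x))%:E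
     = (mass mu (a + k%:Z) * complex.Im S)%:E)%E.
Proof.
move=> lk hy hy' S.
pose w := zeta R (p ^ k) ^+ qres (- (a + k%:Z)) k y
      / zeta R (p ^ k) ^+ qres (- (a + k%:Z)) k y'.
have E x : Om x -> expi (chi_arg R y x - chi_arg R y' x) = w ^+ qres a k x.
  move=> Ox; rewrite /w; rewrite expiB (expi_chi R p_pr (Om_bnd Ox) hy) (expi_chi R p_pr (Om_bnd Ox) hy') exprMn exprVn -!exprM.
  by rewrite [in LHS]mulnC [(qres a k x * qres _ k y')%N]mulnC.
rewrite /S !raddf_sum; split.
  apply: (integral_window p_pr haar (g := fun c => complex.Re (w ^+ c))) => //.
  - exact: level_ge0.
  - exact: constant_at_ge.
  - by move=> x /E <-.
apply: (integral_window p_pr haar (g := fun c => complex.Im (w ^+ c))) => //.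
- exact: level_ge0.
- exact: constant_at_ge.
- by move=> x /E <-.
Qed.

(** The two integrals are the real and imaginary parts of the integral of [f] times the conjugate
    character; [f] sees only residues modulo [p^l], whence [c %% p ^ l]. *)
Lemma chi_test_integral k (y : Qp p) (f : nat -> R[i]) : (l <= k)%N ->
  pZ (- (a + k%:Z)) y ->
  let u x := complex.Re (f (qres a l x)) in
  let v x := complex.Im (f (qres a l x)) in
  let S := \sum_(c < p ^ k | window Om a k c)
     f (c %% p ^ l)%N / zeta R (p ^ k) ^+ (c * qres (- (a + k%:Z)) k y) in
  (\int[mu]_(x in Om) (u x * cos (chi_arg R y x) + v x * sin (chi_arg R y x))%:E
     = (mass mu (a + k%:Z) * complex.Re S)%:E)%E /\
  (\int[mu]_(x in Om) (v x * cos (chi_arg R y x) - u x * sin (chi_arg R y x))%:E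
     = (mass mu (a + k%:Z) * complex.Im S)%:E)%E.
Proof.
move=> lk hy u v S.
pose g c := f (c %% p ^ l)%N / zeta R (p ^ k) ^+ (c * qres (- (a + k%:Z)) k y).
have E x : Om x ->
    ((u x * cos (chi_arg R y x) + v x * sin (chi_arg R y x))
     +i* (v x * cos (chi_arg R y x) - u x * sin (chi_arg R y x)))%C = g (qres a k x).
  move=> Ox; rewrite /g -(expi_chi R p_pr (Om_bnd Ox) hy) qres_modn // -expiN.
  rewrite /u /v; case: (f _) => r s /=; rewrite /expi cosN sinN; simpc.
  by congr (_ +i* _)%C; ring.
rewrite /S !raddf_sum; split.
  apply: (integral_window p_pr haar (g := fun c => complex.Re (g c))) => //.
  - exact: level_ge0.
  - exact: constant_at_ge.
  - by move=> x /E <-.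
apply: (integral_window p_pr haar (g := fun c => complex.Im (g c))) => //.
- exact: level_ge0.
- exact: constant_at_ge.
- by move=> x /E <-.
Qed.

(* Shifting [c] by [p^l] multiplies the sum by a nontrivial root of unity. *)
Lemma high_frequency_sum k (y : Qp p) (f : nat -> R[i]) : (l <= k)%N ->
  pZ (- (a + k%:Z)) y -> ~ pZ (- (a + l%:Z)) y ->
  \sum_(c < p ^ k | window Om a k c)
     f (c %% p ^ l)%N / zeta R (p ^ k) ^+ (c * qres (- (a + k%:Z)) k y) = 0.
Proof.
move=> lk hy ny; set b := - (a + k%:Z); set Y := qres b k y; set Z := zeta R (p ^ k).
(* [h] extends the summand by 0 to all residues; membership in the window at level [k] depends only
   on [c] modulo [p^l]. *)
pose h c : R[i] := if window Om a l (c %% p ^ l)%N then f (c %% p ^ l)%N / Z ^+ (c * Y) else 0.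
have dv : (p ^ l %| p ^ k)%N by rewrite dvdn_exp2l.
have -> : \sum_(c < p ^ k | window Om a k c) f (c %% p ^ l)%N / Z ^+ (c * Y)
          = \sum_(c < p ^ k) h c.
  rewrite big_mkcond; apply: eq_bigr => c _; rewrite /h.
  suff -> : window Om a k c = window Om a l (c %% p ^ l)%N by [].
  apply/asboolP/asboolP => -[x Ox e]; first by exists x => //; rewrite -e qres_modn.
  have [z hz zc] := qres_surj p_pr a (ltn_ord c).
  exists z => //; apply: (Om_cst Ox); apply/(qres_eqm p_pr l (Om_bnd Ox) hz).
  by rewrite e -zc qres_modn.
have ZP := zeta_prim R (pX_gt0 k).
have hS c : h (c + p ^ l)%N = (Z ^+ (p ^ l * Y))^-1 * h c.
  rewrite /h modnDr; case: ifP => _; last by rewrite mulr0.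
  by rewrite mulnDl exprD invfM; ring.
apply: (@eq_mul_fix0 _ (Z ^+ (p ^ l * Y))^-1).
  (* The factor is 1 only if [p^(k-l)] divides [Y], that is, if the lowest [k - l] digits of [y]
     vanish and [y] lies in [p^-(a+l) Z_p]. *)
  rewrite invr_eq1 -(prim_order_dvd ZP) -{1}(subnKC lk) expnD dvdn_pmul2l //.
  apply/negP => /eqP Y0; apply: ny.
  rewrite qres_modn ?leq_subr // in Y0.
  have b0 : pZ b (qp0 p) by [].
  have /(qres_eqm p_pr _ hy b0) : qres b (k - l) y = qres b (k - l) (qp0 p).
    by rewrite Y0 /qres big1 // => i _; rewrite mul0n.
  by have -> : b + (k - l)%N%:Z = - (a + l%:Z) by rewrite /b; lia.
rewrite -[LHS](@sum_shift_periodic _ h _ (p ^ l)) => [|c].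
  by rewrite mulr_sumr; apply: eq_bigr => c _; rewrite hS.
rewrite /h modn_dvdm //; case: ifP => // _; congr (_ / _).
by rewrite -zeta_mod modnMml zeta_mod.
Qed.

Lemma spectral_homogeneous : spectral mu (Om : set (QpM p)) ->
  forall n, qone_child Om n \/ qall_children Om n.
Proof.
move=> [_ [_ [_ [Lam [orth complete]]]]].
apply/(window_homogeneous p_pr Om_bnd Om_cst).
set b := - (a + l%:Z).
pose Lam0 : set (Qp p) := [set y | Lam y /\ pZ b y].
have M0 : mass mu (a + l%:Z) != 0 by rewrite gt_eqF // (mass_gt0 p_pr haar).
apply: (homogeneous_of_orthogonal (Y := window Lam0 b l) p_pr _ (zeta_prim R (pX_gt0 l))).
- by move=> c; apply: window_lt.
- move=> _ _ /asboolP[y [Ly hy] <-] /asboolP[y' [Ly' hy'] <-] ne.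
  have [h1 h2] := chi_sub_integral (leqnn l) hy hy'.
  have [ort1 ort2] := orth y y' Ly Ly'.
  rewrite h1 asboolF in ort1; last by move=> e; rewrite e eqxx in ne.
  rewrite h2 in ort2.
  apply/eqP; rewrite eq_complex /=; apply/andP; split; apply/eqP; apply: (mulfI M0).
    by rewrite mulr0; case: ort1.
  by rewrite mulr0; case: ort2.
(* With fewer low frequencies than residues, some nonzero [f] on the residues is orthogonal to all
   of them. High frequencies are orthogonal to it by [high_frequency_sum], so completeness would
   make [f] vanish on the residues of [Om]. *)
rewrite leqNgt; apply/negP => /(left_kernel_fun (fun c y => (zeta R (p ^ l) ^+ (c * y))^-1)).
move=> [f [[c0 /andP[c0l Cc0] fc0] fP]].
pose u (x : QpM p) := complex.Re (f (qres a l x)).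
pose v (x : QpM p) := complex.Im (f (qres a l x)).
have mu_ : measurable_fun (Om : set (QpM p)) u.
  by apply: (measurable_fun_window p_pr (g := fun c => complex.Re (f c)) Om_bnd Om_cst).
have mv_ : measurable_fun (Om : set (QpM p)) v.
  by apply: (measurable_fun_window p_pr (g := fun c => complex.Im (f c)) Om_bnd Om_cst).
have ae : {ae mu, forall x, Om x -> u x = 0 /\ v x = 0}.
  apply: complete => //.
  - rewrite (integral_window p_pr haar (g := fun c => complex.Re (f c) ^+ 2) al_ge0 Om_bnd Om_cst) //.
    exact: ltry.
  - rewrite (integral_window p_pr haar (g := fun c => complex.Im (f c) ^+ 2) al_ge0 Om_bnd Om_cst) //.
    exact: ltry.
  move=> y Ly.
  have [k [lk hy S0]] : exists k, [/\ (l <= k)%N, pZ (- (a + k%:Z)) y &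
    \sum_(c < p ^ k | window Om a k c)
     f (c %% p ^ l)%N / zeta R (p ^ k) ^+ (c * qres (- (a + k%:Z)) k y) = 0].
    have [hy|ny] := pselect (pZ b y).
      exists l; split=> //; rewrite -[RHS](fP (qres b l y)) ?qres_lt //.
        by apply: eq_bigr => c _; rewrite modn_small.
      by apply/asboolP; exists y.
    (* Large enough for [-(a + k) <= lb y]. *)
    pose k := (l + `|(lb y + a)%R|)%N.
    have lk : (l <= k)%N by rewrite leq_addr.
    have hy : pZ (- (a + k%:Z)) y by move=> n nk; apply: lbP; rewrite /k in nk; lia.
    by exists k; split=> //; apply: high_frequency_sum.
  have [-> ->] := chi_test_integral f lk hy.
  by rewrite S0 mulr0.
case/asboolP: Cc0 => x0 Ox0 x0c.
apply: (negligible_constant p_pr haar (x := x0) al_ge0 ae) => y xy h.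
have Oy : Om y by apply: Om_cst xy.
have [] := h Oy; rewrite /u /v.
have -> : qres a l y = c0 by rewrite -x0c; apply/esym/qres_eqm => //; exact: Om_bnd.
by move=> h1 h2; move/eqP: fc0; apply; apply/eqP; rewrite eq_complex h1 h2 /= !eqxx.
Qed.

End SpectralBasics.

(** * A spectrum of a homogeneous set *)

Section DualSet.
Variables (p : nat) (R : realType) (mu : {measure set (QpM p) -> \bar R}).
Hypothesis p_pr : prime p.
Hypothesis haar : is_haar mu.
Variables (Om : set (Qp p)) (a : int) (l : nat).
Hypothesis al_ge0 : 0 <= a + l%:Z.
Hypothesis Om_bnd : bounded_by Om a.
Hypothesis Om_cst : constant_at Om (a + l%:Z).
Hypothesis Om_ne : Om !=set0.
Hypothesis hom : forall n, qone_child Om n \/ qall_children Om n.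

Let p_gt0 : (0 < p)%N. Proof. exact: prime_gt0. Qed.
Let pX_gt0 k : (0 < p ^ k)%N. Proof. by rewrite expn_gt0 p_gt0. Qed.
Let mOm : measurable (Om : set (QpM p)).
Proof. exact: measurable_window Om_bnd Om_cst. Qed.

Let constant_at_ge k : (l <= k)%N -> constant_at Om (a + k%:Z).
Proof. by move=> lk; apply: constant_at_le Om_cst; rewrite lerD2l lez_nat. Qed.

(** Positions [n] and [- n - 1] are dual: their place values multiply to [p^(-1)], whose exponent is
    the largest that a character does not ignore. *)
Definition dual_set : set (Qp p) :=
  [set y | forall n, dig y n <> 0%N -> qall_children Om (- n - 1)].

Definition dual_upto (k : nat) : set (Qp p) :=
  [set y | dual_set y /\ pZ (- (a + k%:Z)) y].

(** The dual position [- n - 1] is below [a], where all points of [Om] have digit 0; a full level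
    would also produce the digit 1. *)
Lemma dual_set_high y n : dual_set y -> - a <= n -> dig y n = 0%N.
Proof.
move=> Ly an; apply: contrapT => /Ly all.
have [w Ow] := Om_ne; have [w' Ow' [_ d1]] := all w 1%N Ow (prime_gt1 p_pr).
by have := Om_bnd Ow' (k := - n - 1); rewrite d1 => h; have : 1%N = 0%N by apply: h; lia.
Qed.

Lemma dual_upto_bounded k : bounded_by (dual_upto k) (- (a + k%:Z)).
Proof. by move=> y []. Qed.

Lemma dual_all_children k v : (v < k)%N -> qall_children Om (a + (k - v.+1)%N%:Z) ->
  qall_children (dual_upto k) (- (a + k%:Z) + v%:Z).
Proof.
move=> vk all y d [Ly hy] dp; set n := - (a + k%:Z) + v%:Z.
exists (cutdig y n d); last by split; [exact: eqm_cutdig|exact: dig_cutdig].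
split=> [i|i ib]; rewrite cutdigE //.
  case: ifP => _; first exact: Ly.
  case: eqP => [-> _|//].
  by have -> : - n - 1 = a + (k - v.+1)%N%:Z by rewrite /n; lia.
have -> : (i < n) = true by rewrite /n; lia.
exact: hy.
Qed.

Lemma dual_one_child k v : (v < k)%N -> ~ qall_children Om (a + (k - v.+1)%N%:Z) ->
  qone_child (dual_upto k) (- (a + k%:Z) + v%:Z).
Proof.
move=> vk N y y' [Ly _] [Ly' _] e; apply: eqmS => //.
set n := - (a + k%:Z) + v%:Z.
have z t : dual_set t -> dig t n = 0%N.
  move=> Lt; apply: contrapT => /Lt.
  by have -> : - n - 1 = a + (k - v.+1)%N%:Z by rewrite /n; lia.
by rewrite !z.
Qed.

Let C k := window Om a k.
Let Y k := window (dual_upto k) (- (a + k%:Z)) k.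
Let Z k := zeta R (p ^ k).

Let homC k : (l <= k)%N -> forall j, (j < k)%N -> one_child p (C k) j \/ all_children p (C k) j.
Proof.
by move=> lk; apply/(window_homogeneous p_pr Om_bnd) => //; apply: constant_at_ge lk.
Qed.

Let dualY k v : (v < k)%N -> one_child p (Y k) v \/ all_children p (C k) (k - v.+1).
Proof.
move=> vk; have kvk : (k - v.+1 < k)%N by lia.
have [all|N] := pselect (qall_children Om (a + (k - v.+1)%N%:Z)).
  by right; apply/(window_all_children p_pr Om_bnd kvk).
by left; apply/(window_one_child p_pr (@dual_upto_bounded k) vk)/dual_one_child.
Qed.

Let allY k v : (v < k)%N -> qall_children Om (a + (k - v.+1)%N%:Z) -> all_children p (Y k) v.
Proof.
move=> vk all; apply/(window_all_children p_pr (@dual_upto_bounded k) vk).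
exact: dual_all_children.
Qed.

Let homY k : forall j, (j < k)%N -> one_child p (Y k) j \/ all_children p (Y k) j.
Proof.
move=> j jk; case: (dualY jk) => [|all]; [by left|right].
have kj : (k - j.+1 < k)%N by lia.
by apply: allY => //; apply/(window_all_children p_pr Om_bnd kj).
Qed.

Let dualC k v : (l <= k)%N -> (v < k)%N -> one_child p (C k) v \/ all_children p (Y k) (k - v.+1).
Proof.
move=> lk vk; case: (homC lk vk) => [|all]; [by left|right].
apply: allY; first by lia.
have -> : (k - (k - v.+1).+1 = v)%N by lia.
by apply/(window_all_children p_pr Om_bnd vk).
Qed.

Lemma dual_set_orthogonal k y y' : (l <= k)%N -> Y k y -> Y k y' -> y != y' ->
  \sum_(c < p ^ k | C k c) (Z k ^+ y / Z k ^+ y') ^+ c = 0.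
Proof.
move=> lk; apply: (dual_orthogonal p_pr _ _ (zeta_prim R (pX_gt0 k)) (homC lk) (@dualY k)).
  by move=> c; apply: window_lt.
by move=> c; apply: window_lt.
Qed.

(** Orthogonality in the other variable of the character table, by [dual_orthogonal] with the two
    sets exchanged. *)
Lemma Om_orthogonal k c c' : (l <= k)%N -> C k c -> C k c' -> c != c' ->
  \sum_(y < p ^ k | Y k y) (Z k ^+ c / Z k ^+ c') ^+ y = 0.
Proof.
move=> lk; apply: (dual_orthogonal p_pr _ _ (zeta_prim R (pX_gt0 k)) (@homY k) (fun v => dualC lk)).
  by move=> d; apply: window_lt.
by move=> d; apply: window_lt.
Qed.

(** Fourier inversion: multiply the relation for [y] by [Z k ^+ (c0 * y)] and sum over [y]. By
    [Om_orthogonal] only [c = c0] survives, with the factor [|Y|], which is nonzero because the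
    frequency 0 belongs to [Y]. *)
Lemma dual_set_complete k (W : nat -> R[i]) : (l <= k)%N ->
  (forall y, Y k y -> \sum_(c < p ^ k | C k c) W c / Z k ^+ (c * y) = 0) ->
  forall c, C k c -> W c = 0.
Proof.
move=> lk H c0 Cc0; have c0k := window_lt p_pr Cc0.
have Z0 m : Z k ^+ m != 0 by rewrite expf_neq0 ?expi_neq0.
have : \sum_(y < p ^ k | Y k y) Z k ^+ (c0 * y)
         * \sum_(c < p ^ k | C k c) W c / Z k ^+ (c * y) = 0.
  by rewrite big1 // => y Yy; rewrite H ?mulr0.
under eq_bigr do rewrite mulr_sumr.
rewrite exchange_big /= (bigD1 (Ordinal c0k)) //= [X in _ + X]big1 => [|c /andP[Cc ne]]; last first.
  transitivity (W c * \sum_(y < p ^ k | Y k y) (Z k ^+ c0 / Z k ^+ c) ^+ y).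
    rewrite mulr_sumr; apply: eq_bigr => y _.
    by rewrite exprMn exprVn -!exprM; ring.
  by rewrite Om_orthogonal ?mulr0 // eq_sym.
rewrite addr0 (eq_bigr (fun=> W c0)) => [|y _].
  move/eqP; rewrite sumr_const mulrn_eq0 => /orP[|/eqP//].
  rewrite -sum1_card sum_nat_eq0 => /forallP /(_ (Ordinal (pX_gt0 k))).
  suff -> : Ordinal (pX_gt0 k) \in (fun y : 'I_(p ^ k) => Y k y) by [].
  apply/asboolP; exists (qp0 p) => /=; first by split.
  by rewrite /qres big1.
by rewrite mulrCA divff ?mulr1.
Qed.

(** [|u| <= 1 + u^2], and [Om] has finite measure. *)
Lemma square_integrable (u : QpM p -> R) : measurable_fun (Om : set (QpM p)) u ->
  (\int[mu]_(x in Om) (u x ^+ 2)%:E < +oo)%E -> mu.-integrable Om (EFin \o u).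
Proof.
move=> mu2 fin.
have m2 : measurable_fun (Om : set (QpM p)) (fun x => u x ^+ 2) by apply: measurable_funX.
apply: (@le_integrable _ _ _ _ _ _ _ (fun x => (1 + u x ^+ 2)%:E)) => //.
- exact/measurable_EFinP.
- move=> x _; rewrite /= lee_fin [leRHS]ger0_norm; last by rewrite addr_ge0 // sqr_ge0.
  by have := sqr_ge0 (`|u x| - 1); rewrite -(real_normK (num_real (u x))); nra.
- apply/integrableP; split.
    by apply/measurable_EFinP/measurable_funD.
  under eq_integral => x _.
    rewrite gee0_abs ?lee_fin ?addr_ge0 ?sqr_ge0 // EFinD.
    over.
  rewrite ge0_integralD //=; last 2 first.
  + by move=> x _; rewrite lee_fin sqr_ge0.
  + exact/measurable_EFinP.
  rewrite integral_cst // mul1e lte_add_pinfty //.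
  exact: (mu_window_fin p_pr haar al_ge0 Om_bnd Om_cst).
Qed.

Lemma cell_subset k c : (l <= k)%N -> C k c -> cell a k c `<=` Om.
Proof.
move=> lk /asboolP[y Oy e] x [hx e']; apply: (constant_at_ge lk Oy).
by apply/(qres_eqm p_pr k (Om_bnd Oy) hx); rewrite e e'.
Qed.

Lemma integral_combination (D : set (QpM p)) (u v : QpM p -> R) r s : measurable D ->
  mu.-integrable D (EFin \o u) -> mu.-integrable D (EFin \o v) ->
  (\int[mu]_(x in D) (u x * r + v x * s)%:E =
   (fine (\int[mu]_(x in D) (u x)%:E) * r + fine (\int[mu]_(x in D) (v x)%:E) * s)%:E)%E.
Proof.
move=> mD iu iv.
under eq_integral => x _ do rewrite EFinD mulrC [v x * s]mulrC !EFinM.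
rewrite integralD //; try exact: integrableZl.
rewrite !integralZl // EFinD mulrC [_ * s]mulrC !EFinM !fineK //; exact: integrable_fin_num.
Qed.

(** The characters of [dual_upto k] are constant on the cells of level [k], so orthogonality to them
    is a finite linear system for the cell integrals of [u + i v], to which [dual_set_complete]
    applies. *)
Lemma cells_zero (u v : QpM p -> R) k :
  measurable_fun (Om : set (QpM p)) u -> measurable_fun (Om : set (QpM p)) v ->
  mu.-integrable Om (EFin \o u) -> mu.-integrable Om (EFin \o v) ->
  (forall y, dual_set y ->
     (\int[mu]_(x in Om)
         (u x * cos (chi_arg R y x) + v x * sin (chi_arg R y x))%:E = 0)%E /\
     (\int[mu]_(x in Om)
         (v x * cos (chi_arg R y x) - u x * sin (chi_arg R y x))%:E = 0)%E) ->
  (l <= k)%N -> forall c : 'I_(p ^ k), C k c ->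
  (\int[mu]_(x in cell a k c) (u x)%:E = 0)%E /\ (\int[mu]_(x in cell a k c) (v x)%:E = 0)%E.
Proof.
move=> mfu mfv iu iv H lk.
pose U c := fine (\int[mu]_(x in cell a k c) (u x)%:E).
pose V c := fine (\int[mu]_(x in cell a k c) (v x)%:E).
have ic (f : QpM p -> R) (c : 'I_(p ^ k)) : mu.-integrable Om (EFin \o f) -> C k c ->
    mu.-integrable (cell a k c) (EFin \o f).
  move=> i Cc; apply: integrableS i => //; first exact: measurable_cell.
  exact: cell_subset.
suff W0 : forall c, C k c -> (U c +i* V c)%C = 0.
  move=> c Cc; have [U0 V0] := W0 c Cc.
  split; rewrite -[LHS]fineK -/(U c) -/(V c) ?U0 ?V0 //;
    apply: integrable_fin_num; rewrite ?ic //; exact: measurable_cell.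
apply: (@dual_set_complete k (fun c => (U c +i* V c)%C) lk) => _ /asboolP[y [Ly hy] <-].
have [H1 H2] := H y Ly; have ck := constant_at_ge lk.
have E x : Om x -> expi (chi_arg R y x) = Z k ^+ (qres a k x * qres (- (a + k%:Z)) k y).
  by move=> Ox; apply: (expi_chi R p_pr (Om_bnd Ox) hy).
have mc : measurable_fun (Om : set (QpM p)) (fun x => cos (chi_arg R y x)).
  apply: (measurable_fun_window p_pr (g := fun c => complex.Re (Z k ^+ (c * qres (- (a + k%:Z)) k y))) Om_bnd ck).
  by move=> x /E <-.
have ms : measurable_fun (Om : set (QpM p)) (fun x => sin (chi_arg R y x)).
  apply: (measurable_fun_window p_pr (g := fun c => complex.Im (Z k ^+ (c * qres (- (a + k%:Z)) k y))) Om_bnd ck).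
  by move=> x /E <-.
pose g (c : nat) := (U c +i* V c)%C / Z k ^+ (c * qres (- (a + k%:Z)) k y).
have gE (c : 'I_(p ^ k)) : C k c ->
  (\int[mu]_(x in cell a k c) (u x * cos (chi_arg R y x) + v x * sin (chi_arg R y x))%:E
    = (complex.Re (g c))%:E)%E /\
  (\int[mu]_(x in cell a k c) (v x * cos (chi_arg R y x) - u x * sin (chi_arg R y x))%:E
    = (complex.Im (g c))%:E)%E.
  move=> Cc; have /asboolP[w Ow wc] := Cc.
  have Ecs x : cell a k c x -> expi (chi_arg R y x) = expi (chi_arg R y w).
    move=> cx; rewrite (E x (cell_subset lk Cc cx)) (E w Ow) wc.
    by case: cx => _ ->.
  have Ec x : cell a k c x -> cos (chi_arg R y x) = cos (chi_arg R y w).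
    by move=> /Ecs /(congr1 (@complex.Re R)).
  have Es x : cell a k c x -> sin (chi_arg R y x) = sin (chi_arg R y w).
    by move=> /Ecs /(congr1 (@complex.Im R)).
  have -> : g c = ((U c * cos (chi_arg R y w) + V c * sin (chi_arg R y w))
    +i* (V c * cos (chi_arg R y w) + U c * - sin (chi_arg R y w)))%C.
    rewrite /g -wc -E // -expiN /expi cosN sinN; simpc.
    by congr (_ +i* _)%C; ring.
  have mC := measurable_cell p_pr a c.
  split.
    rewrite (eq_integral (fun x => (u x * cos (chi_arg R y w) + v x * sin (chi_arg R y w))%:E)).
      exact: (integral_combination _ _ mC (ic u c iu Cc) (ic v c iv Cc)).
    by move=> x; rewrite inE => cx; rewrite (Ec x cx) (Es x cx).
  rewrite (eq_integral (fun x => (v x * cos (chi_arg R y w) + u x * - sin (chi_arg R y w))%:E)).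
    exact: (integral_combination _ _ mC (ic v c iv Cc) (ic u c iu Cc)).
  by move=> x; rewrite inE => cx; rewrite (Ec x cx) (Es x cx) mulrN.
move: H1; rewrite (integral_cells mu p_pr Om_bnd ck); last first.
  exact: (measurable_funD (measurable_funM mfu mc) (measurable_funM mfv ms)).
rewrite (eq_bigr (fun c : 'I_(p ^ k) => (complex.Re (g c))%:E)) => [|c Cc]; last by have [] := gE c Cc.
rewrite sumEFin -raddf_sum => -[H1].
move: H2; rewrite (integral_cells mu p_pr Om_bnd ck); last first.
  exact: (measurable_funB (measurable_funM mfv mc) (measurable_funM mfu ms)).
rewrite (eq_bigr (fun c : 'I_(p ^ k) => (complex.Im (g c))%:E)) => [|c Cc]; last by have [] := gE c Cc.
rewrite sumEFin -raddf_sum => -[H2].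
by apply/eqP; rewrite eq_complex /= -/C H1 H2 !eqxx.
Qed.

(** Dynkin's argument: the sets over whose trace on [Om] the integral of [u] vanishes form a
    lambda-system, containing a pi-system that generates the Borel sets. *)
Lemma ae_zero_of_integrals (u : QpM p -> R) : mu.-integrable Om (EFin \o u) ->
  (forall k (E : set (Qp p)), (l <= k)%N -> bounded_by E a -> constant_at E (a + k%:Z) ->
     E `<=` Om -> (\int[mu]_(x in E) (u x)%:E = 0)%E) ->
  {ae mu, forall x, Om x -> u x = 0}.
Proof.
move=> iu H.
(* Balls alone are not stable under intersection, disjoint ones meeting in the empty set; bounded
   sets constant at some level are, and generate the same sigma-algebra. *)
pose G : set (set (QpM p)) := [set A | exists a' n, bounded_by A a' /\ constant_at A n].
have mE : measurable = <<s G >> :> set (set (QpM p)).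
  apply/seteqP; split.
    apply: smallest_sub; first exact: smallest_sigma_algebra.
    move=> _ [x [m ->]]; apply: sub_sigma_algebra.
    exists (Num.min (lb x) (- m)), (- m); split.
      move=> y /qballE => /(_ p_pr) xy k; rewrite lt_min => /andP[h1 h2].
      by rewrite -xy // lbP.
    move=> y z /qballE => /(_ p_pr) xy yz; apply/qballE => //.
    exact: eqm_trans xy yz.
  apply: smallest_sub; first exact: sigma_algebra_measurable.
  move=> A [a' [n [bA cA]]].
  pose m := Num.min a' n.
  apply: (@measurable_window p p_pr A m `|n - m|%N).
    by move=> x /bA hx k km; apply: hx; apply: lt_le_trans km _; rewrite ge_min lexx.
  by have -> : m + `|n - m|%N%:Z = n by rewrite /m; lia.
pose P (S : set (QpM p)) : Prop := (\int[mu]_(x in S `&` Om) (u x)%:E = 0)%E.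
have iS (S : set (QpM p)) : measurable S -> mu.-integrable (S `&` Om) (EFin \o u).
  by move=> mS; apply: integrableS iu => //; exact: measurableI.
have PT : P setT by rewrite /P setTI; apply: (H l).
have PP (S : set (QpM p)) : measurable S -> P S.
  rewrite {1}mE; apply: (dynkin_induction mE) => //.
  - move=> A B [a1 [n1 [b1 c1]]] [a2 [n2 [b2 c2]]].
    exists a1, (Num.max n1 n2); split=> [x [/b1]//|x y [Ax Bx] xy].
    split; [apply: c1 Ax _|apply: c2 Bx _]; apply: eqmW xy; rewrite le_max lexx ?orbT //.
  - move=> A [a1 [n1 [b1 c1]]]; rewrite /P.
    (* [a + k] is at least [n1] and [a + l], the levels of [A] and [Om]. *)
    pose k := (l + `|(n1 - a)%R|)%N.
    apply: (H k); first by rewrite leq_addr.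
    + by move=> x [_ /Om_bnd].
    + move=> x y [Ax Ox] xy; split; [apply: c1 Ax _|apply: (Om_cst Ox)]; apply: eqmW xy; rewrite /k; lia.
    + exact: subIsetr.
  - move=> D mD PD; rewrite /P.
    have e : Om = (D `&` Om) `|` (~` D `&` Om) by rewrite -setIUl setUv setTI.
    have := PT; rewrite /P setTI {1}e integral_setU //.
    + by rewrite PD add0e.
    + exact: measurableI.
    + by apply: measurableI => //; exact: measurableC.
    + by rewrite -e; case/integrableP: iu.
    + by apply/disj_setPS => x [[Dx _] [nD _]].
  - move=> F mF tF PF; rewrite /P setI_bigcupl integral_bigcup //.
    + by apply: eseries0 => i _ _; exact: PF.
    + exact: trivIset_setIr.
    + by move=> k; exact: measurableI.
    + by rewrite -setI_bigcupl; apply: iS; exact: bigcup_measurable.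
have : ae_eq mu Om (EFin \o u) (cst 0%E).
  apply: integral_ae_eq => // A sub mA.
  have := PP A mA; rewrite /P (setIidl sub) => ->.
  by rewrite integral0.
by apply: filterS => x h Ox; have /= [] := h Ox.
Qed.

Lemma homogeneous_spectral : (0 < mu Om)%E -> spectral mu (Om : set (QpM p)).
Proof.
move=> Om_gt0; split=> //; split=> //; split.
  exact: (mu_window_fin p_pr haar al_ge0 Om_bnd Om_cst).
exists dual_set; split.
  move=> y y' Ly Ly'; case: asboolP => [<-|ne].
    split.
      under eq_integral do rewrite subrr cos0.
      by rewrite integral_cst // mul1e.
    under eq_integral do rewrite subrr sin0.
    by rewrite integral0.
  pose k := (l + `|(lb y + a)%R| + `|(lb y' + a)%R|)%N.
  have lk : (l <= k)%N by rewrite /k -addnA leq_addr.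
  have hy : pZ (- (a + k%:Z)) y by move=> n nk; apply: lbP; rewrite /k in nk; lia.
  have hy' : pZ (- (a + k%:Z)) y' by move=> n nk; apply: lbP; rewrite /k in nk; lia.
  have [-> ->] := chi_sub_integral p_pr haar al_ge0 Om_bnd Om_cst lk hy hy'.
  suff -> : \sum_(c < p ^ k | window Om a k c)
     (zeta R (p ^ k) ^+ qres (- (a + k%:Z)) k y
      / zeta R (p ^ k) ^+ qres (- (a + k%:Z)) k y') ^+ c = 0 by rewrite mulr0.
  apply: dual_set_orthogonal => //.
  - by apply/asboolP; exists y.
  - by apply/asboolP; exists y'.
  (* Equal residues mean agreement below [- a], and from [- a] on the digits of both frequencies are
     0; so the frequencies would be equal. *)
  apply/eqP => /(qres_eqm p_pr k hy hy'); have -> : - (a + k%:Z) + k%:Z = - a by lia.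
  move=> e; apply: ne; apply: Qp_ext => n i _.
  by have [/e//|h] := ltP i (- a); rewrite !dual_set_high.
move=> u v mfu mfv u2 v2 H.
have iu := square_integrable mfu u2; have iv := square_integrable mfv v2.
have cz := cells_zero mfu mfv iu iv H.
have sub k (E : set (Qp p)) c : E `<=` Om -> window E a k c -> C k c.
  by move=> s /asboolP[x Ex e]; apply/asboolP; exists x => //; apply: s.
have u0 : {ae mu, forall x, Om x -> u x = 0}.
  apply: ae_zero_of_integrals => // k E lk bE cE s.
  rewrite (integral_cells mu p_pr bE cE); last exact: (measurable_funS mOm s mfu).
  by rewrite big1 // => c /(sub _ _ _ s) /(cz k lk)[].
have v0 : {ae mu, forall x, Om x -> v x = 0}.
  apply: ae_zero_of_integrals => // k E lk bE cE s.
  rewrite (integral_cells mu p_pr bE cE); last exact: (measurable_funS mOm s mfv).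
  by rewrite big1 // => c /(sub _ _ _ s) /(cz k lk)[].
by move: u0 v0; apply: (@filterS2 _ _ (ae_filter_ringOfSetsType mu)) => x h1 h2 Ox; split; [exact: h1|exact: h2].
Qed.

End DualSet.

(** * Reduction to a finite window and the three equivalent properties *)

Lemma compact_open_window (p : nat) (Om : set (Qp p)) : prime p ->
  qp_compact Om -> qp_open Om -> exists a (l : nat),
    [/\ 0 <= a + l%:Z, bounded_by Om a & constant_at Om (a + l%:Z)].
Proof.
move=> p_pr cO oO.
have [a bO] := compact_bounded p_pr cO.
have [N kO] := compact_open_constant p_pr cO oO.
(* This makes [a + l] at least [N], and nonnegative, where the mass of balls is known to be finite
   and positive. *)
exists a, (`|a| + `|N|)%N; split=> //; first by lia.
by apply: constant_at_le kO; lia.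
Qed.

Theorem theorem1p1 (p : nat) (R : realType)
    (mu : {measure set (QpM p) -> \bar R}) (Om : set (QpM p)) :
  prime p -> is_haar mu ->
  qp_compact Om -> qp_open Om -> (0 < mu Om)%E ->
  (spectral mu Om <-> p_homogeneous Om) /\
  (p_homogeneous Om <-> tiles mu Om).
Proof.
move=> p_pr haar cO oO Om_gt0.
have [a [l [al bO kO]]] := compact_open_window p_pr cO oO.
have ne : Om !=set0.
  by apply/set0P/eqP => e; move: Om_gt0; rewrite e measure0 ltxx.
split; rewrite (p_homogeneousP p_pr Om); split=> h.
- exact: (spectral_homogeneous p_pr haar al bO kO h).
- exact: (homogeneous_spectral p_pr haar al bO kO ne h Om_gt0).
- exact: (homogeneous_tiles mu p_pr bO kO ne h).
- exact: (tiles_homogeneous p_pr haar al bO kO h).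
Qed.
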